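(* Let $C$ be the universal constant described in the context (for instance $C=24$). Let $n\ge 1$, let $P_1,\dots,P_n$ be probability distributions on a common measurable space, and define $$\mathbb{P}_n=\mathbb{E}_{\pi\sim\mathrm{Unif}(S_n)}\left[\bigotimes_{i=1}^n P_{\pi(i)}\right],\qquad \mathbb{Q}_n=\left(\frac1n\sum_{i=1}^n P_i\right)^{\otimes n}.$$ Let $M\in\mathbb{R}^{n\times n}$ be the channel overlap matrix generated by $P_1,\dots,P_n$, with eigenvalues $1=\lambda_1(M)\ge\lambda_2(M)\ge\cdots\ge\lambda_n(M)\ge0$. Then $$\chi^2(\mathbb{P}_n\|\mathbb{Q}_n)\le C\left(\prod_{i=2}^n\frac{1}{1-\lambda_i(M)}-1-\sum_{i=2}^n\lambda_i(M)\right),$$ where the right-hand side is interpreted as $+\infty$ if $\lambda_2(M)=1$.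
   Context: $\mathrm{Unif}(S_n)$ is the uniform distribution on the symmetric group $S_n$, so $\mathbb{P}_n=\frac{1}{n!}\sum_{\pi\in S_n}P_{\pi(1)}\otimes\cdots\otimes P_{\pi(n)}$. The channel overlap matrix $M=M(P_1,\dots,P_n)$ has entries $$M_{ij}=\frac1n\int\frac{\mathrm{d}P_i\,\mathrm{d}P_j}{\mathrm{d}\overline P}=\frac1n\int\frac{\mathrm{d}P_i}{\mathrm{d}\overline P}\frac{\mathrm{d}P_j}{\mathrm{d}\overline P}\,\mathrm{d}\overline P,\qquad \overline P=\frac1n\sum_{i=1}^n P_i.$$ It is symmetric positive semidefinite and doubly stochastic. The chi-squared divergence is $\chi^2(P\|Q)=\int\left(\frac{\mathrm{d}P}{\mathrm{d}Q}\right)^2\mathrm{d}Q-1$ for $P\ll Q$ (and $+\infty$ otherwise). Constant $C$: a universal constant $C>0$ such that for all $n\ge1$, $0\le k\le n$ and $z\in\mathbb{C}^n$ with $\sum_i z_i=0$ and $\sum_i|z_i|^2=n$ one has $|e_k(z)|\le\sqrt{C\binom{n}{k}}$, where $e_k(z)=\sum_{S\subseteq\{1,\dots,n\},|S|=k}\prod_{i\in S}z_i$; the value $C=24$ is admissible. *)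

(* Defs.v *)
From HB Require Import structures.
From mathcomp Require Import all_boot all_order all_algebra perm.
From mathcomp Require Import complex.
From mathcomp Require Import all_classical all_reals all_analysis.

Set Implicit Arguments.
Unset Strict Implicit.
Unset Printing Implicit Defensive.

Import Order.TTheory GRing.Theory Num.Theory.
Import numFieldNormedType.Exports.
Local Open Scope classical_set_scope.
Local Open Scope ring_scope.
Local Open Scope charge_scope.
Local Open Scope ereal_scope.

Section mixture.
Context {d : measure_display} {T : measurableType d} {R : realType}.
Context {I : finType}.

(* The point i0 only witnesses that I is nonempty, so that the average is again
   a probability; the value does not depend on it. *)
Definition mixture (i0 : I) (P : I -> probability T R) (A : set T) : \bar R :=
  (#|I|%:R^-1)%R%:E * \sum_(i : I) P i A.

Variables (i0 : I) (P : I -> probability T R).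
Local Notation mix := (mixture i0 P).

Let mixture0 : mix set0 = 0.
Proof. by rewrite /mixture big1 ?mule0. Qed.

Let mixture_ge0 A : 0 <= mix A.
Proof. by rewrite mule_ge0 ?lee_fin ?invr_ge0 ?sume_ge0. Qed.

Let mixture_sigma_additive : semi_sigma_additive mix.
Proof.
move=> F mF tF mUF; rewrite [X in X @ \oo --> _](_ : _ =
    (fun n => (#|I|%:R^-1)%R%:E * \sum_(i : I) \sum_(0 <= k < n) P i (F k))).
  by apply: cvgeZl => //; apply: cvg_nnesum => i _;
    [exact: nearW (fun n => sume_ge0 _ _)
    |exact: measure_semi_sigma_additive].
apply/funext => n; rewrite /mixture exchange_big/= ge0_sume_distrr// => k _.
exact: sume_ge0.
Qed.

HB.instance Definition _ := isMeasure.Build _ _ _ mix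
  mixture0 mixture_ge0 mixture_sigma_additive.

Let mixture_setT : mix setT = 1.
Proof.
have I0 : (#|I|%:R != 0 :> R)%R.
  by rewrite pnatr_eq0 -lt0n; apply/card_gt0P; exists i0.
rewrite /mixture (eq_bigr (fun=> 1)); last by move=> i _; exact: probability_setT.
by rewrite sumEFin sumr_const -EFinM mulVf.
Qed.

HB.instance Definition _ := Measure_isProbability.Build _ _ _
  mix mixture_setT.

End mixture.

Section product_probability.
Context {d : measure_display} {T : measurableType d} {R : realType}.

Definition consT n (xt : T * n.-tuple T) : n.+1.-tuple T :=
  [the n.+1.-tuple T of xt.1 :: xt.2].

Lemma measurable_consT n : measurable_fun [set: T * n.-tuple T] (@consT n).
Proof. exact: measurable_cons. Qed.

HB.instance Definition _ n :=
  isMeasurableFun.Build _ _ _ _ (@consT n) (@measurable_consT n).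

Fixpoint prod_proba n : ('I_n -> probability T R) -> probability (n.-tuple T) R :=
  match n with
  | 0 => fun=> \d_[tuple]
  | m.+1 => fun mu => distribution
      (mu ord0 \x prod_proba (fun i : 'I_m => mu (lift ord0 i))) (@consT m)
  end.

Lemma prod_probaE n (mu : 'I_n -> probability T R) (A : 'I_n -> set T) :
  (forall i, measurable (A i)) ->
  prod_proba mu [set t | forall i, A i (tnth t i)] = \prod_(i < n) mu i (A i).
Proof.
elim: n mu A => [|n IHn] mu A mA.
  by rewrite big_ord0 /= diracE mem_set// => -[].
have mE m (B : 'I_m -> set T) : (forall i, measurable (B i)) ->
    measurable [set t : m.-tuple T | forall i, B i (tnth t i)].
  move=> mB; rewrite [X in measurable X](_ : _ =
      \bigcap_(i in [set: 'I_m]) ((fun t : m.-tuple T => tnth t i) @^-1` B i)).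
    apply: fin_bigcap_measurable => [|i _]; first exact: finite_finset.
    rewrite -[X in measurable X]setTI.
    exact: (measurable_tnth i measurableT (mB i)).
  by apply/seteqP; split => t /= Bt i; [move=> _; exact: Bt|exact: (Bt i)].
rewrite big_ord_recl -IHn// -(product_measure1E _ _ (mA ord0)); last first.
  exact: (mE _ (fun i => A (lift ord0 i))).
rewrite /= /distribution /pushforward; congr (_ _).
apply/seteqP; split => -[x t] /=.
  move=> At; split; first exact: (At ord0).
  by move=> i; have := At (lift ord0 i); rewrite tnthS.
move=> [Ax At] i; have [j ->|->] := unliftP ord0 i; last exact: Ax.
by rewrite tnthS; exact: At.
Qed.

End product_probability.

Section chi2.
Context {d : measure_display} {T : measurableType d} {R : realType}.

Definition density (nu mu : probability T R) : T -> \bar R :=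
  'd (charge_of_finite_measure nu) '/d mu.

Definition chi2 (nu mu : probability T R) : \bar R :=
  if `[< nu `<< mu >] then \int[mu]_x (density nu mu x ^+ 2) - 1 else +oo.

(* The densities are bounded by n.+1 almost everywhere, so the integral is
   finite and nothing is lost by fine. *)
Definition overlap_mx n (P : 'I_n.+1 -> probability T R) : 'M[R]_n.+1 :=
  let Pbar : probability T R := mixture ord0 P in
  \matrix_(i, j)
    (n.+1%:R^-1 *
     fine (\int[Pbar]_x (density (P i) Pbar x * density (P j) Pbar x)%E))%R.

End chi2.

Local Open Scope complex_scope.
Local Close Scope ereal_scope.

Definition esymf (K : comNzRingType) n (z : 'I_n -> K) (k : nat) : K :=
  \sum_(S : {set 'I_n} | #|S| == k) \prod_(i in S) z i.

Definition esymf_constant (R : realType) (C : R) : Prop :=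
  0 < C /\
  forall (n k : nat) (z : 'I_n -> R[i]), (1 <= n)%N -> (k <= n)%N ->
    \sum_(i < n) z i = 0 -> \sum_(i < n) `|z i| ^+ 2 = n%:R ->
    `|esymf z k| <= (Num.sqrt (C * 'C(n, k)%:R))%:C.

(* Main.v *)
Require Import Defs.
From HB Require Import structures.
From mathcomp Require Import all_boot all_order all_algebra perm.
From mathcomp Require Import fingroup cyclic separable cyclotomic.
From mathcomp Require Import spectral complex.
From mathcomp Require Import all_classical all_reals all_analysis.
From mathcomp Require Import measurable_realfun ring lra.

Set Implicit Arguments.
Unset Strict Implicit.
Unset Printing Implicit Defensive.

Import Order.TTheory GRing.Theory Num.Theory.
Local Open Scope ring_scope.

(** The argument turns the divergence into a permanent and bounds that permanent
    by complex Gaussian integration.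

    Write N for the number of channels and M for their overlap matrix. With
    g i the density of P i with respect to the average channel, the permutation
    mixture has density (1/N!) sum_s prod_i g (s i) (t_i); squaring and
    integrating coordinate by coordinate gives
      chi2 + 1 = N^N / N! * permanent M            ([chi2_permanent]).

    M is symmetric, doubly stochastic and positive semidefinite. Its eigenvalue 1
    is simple unless the claimed bound is infinite. So M = A A^H
    (A^H the conjugate transpose) where column 0 of A, which comes from the
    eigenvalue 1, is constant of squared modulus 1/N, and the other columns have
    sum zero, are orthogonal, and have as squared norms the remaining eigenvalues
    lam_l ([stochastic_gram]).

    By the Wick formula permanent (A A^H) is the mean of
    |prod_i (sum_l A_il z_l)|^2 over independent standard complex Gaussians
    z_l. In polar coordinates the phases of z_l are uniform and the squared
    moduli t_l are standard exponential. Only finitely many Fourier modes occur,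
    so the phases are averaged over roots of unity and only the t_l are
    integrated ([permanent_gram], [permanent_gram_integral]). The factor i of the
    product is a multiple of z_0 plus w_i, where w has sum zero and, by
    orthogonality, squared norm s = sum_l lam_l t_l. Averaging over the phase of
    z_0 separates the degrees: what is left is the sum over k of
    (t_0 / N)^(N - k) |e_k(w)|^2. Here e_0 = 1, e_1 = 0, and the hypothesis on
    the constant C bounds the other |e_k(w)|^2 by C 'C(N, k) (s / N)^k
    ([sum_prod_coef_le]).

    Integrating t_0 leaves N! / N^N times at most 1 + C (e^s - 1 - s), whose mean
    is explicit because E e^s = prod_l (1 - lam_l)^-1 and E s = sum_l lam_l
    ([permanent_bound]). *)

(** * Permanents of Gram matrices and the Wick formula *)

Definition permanent (K : comNzRingType) n (A : 'M[K]_n) : K :=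
  \sum_(s : 'S_n) \prod_i A i (s i).

Definition fiber_card n (T : eqType) (f : 'I_n -> T) (l : T) : nat :=
  \sum_i (f i == l).

Lemma fiber_card_le n (T : eqType) (f : 'I_n -> T) (l : T) : (fiber_card f l <= n)%N.
Proof.
rewrite -[leqRHS]card_ord -sum1_card; apply: leq_sum => i _.
by case: eqP.
Qed.

Lemma fiber_card_lift n (T : eqType) (f : 'I_n.+1 -> T) k l :
  fiber_card f l = ((f k == l) + fiber_card (fun i => f (lift k i)) l)%N.
Proof. by rewrite /fiber_card (bigD1_ord k). Qed.

(** A permutation of n.+1 points is determined by the image k of the first point
    and by the induced permutation of the others. *)
Lemma sum_perm_lift (V : nmodType) n (F : 'S_n.+1 -> V) :
  \sum_s F s = \sum_(k : 'I_n.+1) \sum_(s : 'S_n) F (lift_perm ord0 k s).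
Proof.
rewrite (partition_big (fun s : 'S_n.+1 => s ord0) predT) //=.
apply: eq_bigr => k _; rewrite (reindex (lift_perm ord0 k)); last first.
  pose ulsf i (s : 'S_n.+1) j := odflt j (unlift (s i) (s (lift i j))).
  have ulsfK i (s : 'S_n.+1) j : lift (s i) (ulsf i s j) = s (lift i j).
    rewrite /ulsf; have := neq_lift i j.
    by rewrite -(can_eq (permK s)) => /unlift_some[] ? ? ->.
  have inj_ulsf : injective (ulsf ord0 _).
    move=> s; apply: can_inj (ulsf (s ord0) s^-1%g) _ => j.
    by rewrite {1}/ulsf ulsfK !permK liftK.
  exists (fun s => perm (inj_ulsf s)) => [s _ | s].
    by apply/permP=> j; rewrite permE /ulsf lift_perm_lift lift_perm_id liftK.
  move/(s _ =P _) => si0; apply/permP=> j.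
  case: (unliftP ord0 j) => [j'|] ->; rewrite ?lift_perm_id //.
  by rewrite lift_perm_lift -si0 permE ulsfK.
by apply: eq_bigl => s; rewrite lift_perm_id eqxx.
Qed.

(** Two functions are rearrangements of each other exactly when their fibers have
    equal sizes, and a rearranging permutation is then one bijection per fiber. The
    induction expands along the value at the first point, as in the Laplace
    expansion of a permanent. *)
Lemma card_rearrangements n (T : finType) (f g : 'I_n -> T) :
  (\sum_(s : 'S_n) [forall i, f i == g (s i)] =
   \prod_(l : T) ((fiber_card f l == fiber_card g l) * (fiber_card f l)`!))%N.
Proof.
elim: n f g => [|n IHn] f g.
  rewrite [RHS]big1 => [|l _]; last by rewrite /fiber_card !big_ord0 eqxx.
  rewrite (eq_bigr (fun=> 1%N)) => [|s _]; first by rewrite sum1_card card_Sn.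
  by case: forallP => // -[] [].
rewrite sum_perm_lift; pose l0 := f ord0.
transitivity (\sum_k (g k == l0) *
    \prod_l ((fiber_card f l == fiber_card g l) * (fiber_card (fun i => f (lift ord0 i)) l)`!))%N.
  apply: eq_bigr => k _; have [gk|gk] := eqVneq (g k) l0; last first.
    rewrite mul0n big1 // => s _; case: forallP => // /(_ ord0).
    by rewrite lift_perm_id eq_sym (negbTE gk).
  have fgl l : (fiber_card f l == fiber_card g l) =
      (fiber_card (fun i => f (lift ord0 i)) l == fiber_card (fun i => g (lift k i)) l).
    by rewrite (fiber_card_lift f ord0) (fiber_card_lift g k) gk eqn_add2l.
  rewrite mul1n; under [RHS]eq_bigr => l _ do rewrite fgl.
  rewrite -IHn; apply: eq_bigr => s _; congr nat_of_bool.
  apply/forallP/forallP => fg i; first by have := fg (lift ord0 i); rewrite lift_perm_lift.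
  have [j ->|->] := unliftP ord0 i; first by rewrite lift_perm_lift.
  by rewrite lift_perm_id gk.
rewrite -big_distrl /= -/(fiber_card g l0) (bigD1 l0) // [RHS](bigD1 l0) //= mulnA.
congr muln; last first.
  apply: eq_bigr => l ll0; congr (_ * _`!)%N.
  by rewrite (fiber_card_lift f ord0) [f _ == l]eq_sym (negbTE ll0).
have [fg|] := eqVneq (fiber_card f l0) (fiber_card g l0); last by rewrite muln0.
by rewrite -fg mul1n mul1n (fiber_card_lift f ord0) eqxx add1n factS.
Qed.

Section wick.
Variables (K : numClosedFieldType) (n m : nat) (A : 'M[K]_(n, m)).

Definition exponents (f : {ffun 'I_n -> 'I_m}) : {ffun 'I_m -> 'I_n.+1} :=
  [ffun l => inord (fiber_card f l)].

Lemma exponentsE f l : exponents f l = fiber_card f l :> nat.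
Proof. by rewrite ffunE inordK // ltnS fiber_card_le. Qed.

(** The coefficient of the monomial with exponents a in prod_i sum_l A_il z_l. *)
Definition prod_coef (a : {ffun 'I_m -> 'I_n.+1}) : K :=
  \sum_(f | exponents f == a) \prod_i A i (f i).

Lemma prod_sumE (z : 'I_m -> K) :
  \prod_i \sum_l A i l * z l = \sum_a prod_coef a * \prod_l z l ^+ a l.
Proof.
rewrite bigA_distr_bigA (partition_big exponents predT) //=.
apply: eq_bigr => a _; rewrite mulr_suml; apply: eq_bigr => f /eqP <-.
rewrite big_split /=; congr (_ * _).
under [RHS]eq_bigr => l _ do rewrite exponentsE /fiber_card -prodrXr.
rewrite exchange_big; apply: eq_bigr => i _; rewrite (bigD1 (f i)) //= eqxx.
by rewrite big1 ?mulr1 // => l; rewrite eq_sym => /negbTE ->.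
Qed.

(** Wick formula: both sides expand over pairs of functions f, g, and the
    permutations carrying f to g are counted by [card_rearrangements]. The
    factorials are the moments of standard complex Gaussian monomials, which are
    pairwise orthogonal. *)
Lemma permanent_gram :
  permanent (\matrix_(i, j) \sum_l A i l * (A j l)^* ) =
  \sum_a `|prod_coef a| ^+ 2 * (\prod_l (a l)`!)%:R.
Proof.
pose q (f : {ffun 'I_n -> 'I_m}) := \prod_i A i (f i).
transitivity (\sum_(f : {ffun 'I_n -> 'I_m}) \sum_(g : {ffun 'I_n -> 'I_m})
   q f * (q g)^* * (\sum_(s : 'S_n) [forall i, f i == g (s i)])%:R).
  rewrite /permanent.
  under eq_bigr => s _ do under eq_bigr => i _ do rewrite mxE.
  under eq_bigr => s _ do rewrite bigA_distr_bigA.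
  rewrite exchange_big; apply: eq_bigr => f _.
  under [RHS]eq_bigr => g _ do rewrite natr_sum mulr_sumr.
  rewrite exchange_big; apply: eq_bigr => s _ /=.
  (* for fixed s, exactly one g satisfies f i = g (s i) for all i *)
  pose g := [ffun j => f ((s^-1)%g j)].
  rewrite (bigD1 g) //= [X in _ + X]big1 => [|h hg]; last first.
    case: forallP => [fh|]; last by rewrite mulr0.
    case/eqP: hg; apply/ffunP => j; rewrite ffunE.
    by rewrite (eqP (fh _)) permKV.
  have -> : [forall i, f i == g (s i)].
    by apply/forallP => i; rewrite ffunE permK.
  rewrite mulr1 addr0 big_split /= rmorph_prod; congr (_ * _).
  rewrite [RHS](reindex_inj (@perm_inj _ s)) /=; apply: eq_bigr => i _.
  by rewrite ffunE permK.
rewrite (partition_big exponents predT) //=; apply: eq_bigr => a _.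
rewrite normCK rmorph_sum /= -mulrA mulr_suml; apply: eq_bigr => f /eqP fa.
rewrite (bigID (fun g => exponents g == a)) /= [X in _ + X]big1 => [|g ga].
  rewrite addr0 mulr_suml mulr_sumr; apply: eq_bigr => g /eqP ga.
  rewrite card_rearrangements mulrA; congr (_ * _%:R); apply: eq_bigr => l _.
  by rewrite -!exponentsE fa ga eqxx mul1n.
rewrite card_rearrangements.
have /existsP[l fgl] : [exists l, fiber_card f l != fiber_card g l].
  rewrite -negb_forall; apply: contra ga => /forallP fg.
  by rewrite -fa; apply/eqP/ffunP => l; apply: ord_inj; rewrite !exponentsE (eqP (fg l)).
by rewrite (bigD1 l) //= (negbTE fgl) !mul0n mulr0.
Qed.

End wick.

(** * Averaging over roots of unity *)

Section parseval.
Variable K : numClosedFieldType.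

Lemma prim_root_exists n : (0 < n)%N -> exists z : K, n.-primitive_root z.
Proof.
move=> n0; have [r Dr] := closed_field_poly_normal ('X^n - 1 : {poly K}).
rewrite (monicP (monic_Xn_sub_1 _ n0)) scale1r in Dr.
have rn : all n.-unity_root r.
  by apply/allP => z; rewrite -root_prod_XsubC -Dr.
have sz : (n < (size r).+1)%N.
  by rewrite -(size_prod_XsubC r id) -Dr size_Xn_sub_1.
have [|z] := hasP (has_prim_root n0 rn _ sz); last by exists z.
by rewrite -separable_prod_XsubC -Dr separable_Xn_sub_1 // pnatr_eq0 -lt0n.
Qed.

Lemma norm_prim_root n (z : K) : n.+1.-primitive_root z -> `|z| = 1.
Proof.
move=> pz; apply/eqP; rewrite -(@pexpr_eq1 _ _ n.+1) //.
by rewrite -normrX (prim_expr_order pz) normr1.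
Qed.

Lemma parseval (I J : finType) (phi : I -> J -> K) (c : K)
    (orth : forall a b, \sum_i phi i a * (phi i b)^* = c *+ (a == b)) (q : J -> K) :
  \sum_i `|\sum_a q a * phi i a| ^+ 2 = c * \sum_a `|q a| ^+ 2.
Proof.
under eq_bigr => i _ do rewrite normCK rmorph_sum mulr_suml.
rewrite exchange_big mulr_sumr; apply: eq_bigr => a _ /=.
under eq_bigr => i _ do rewrite mulr_sumr.
rewrite exchange_big (bigD1 a) //= [X in _ + X]big1 => [|b ba].
  rewrite addr0 normCK; under eq_bigr => i _ do rewrite rmorphM mulrACA.
  by rewrite -mulr_sumr orth eqxx mulrC.
under eq_bigr => i _ do rewrite rmorphM mulrACA.
by rewrite -mulr_sumr orth eq_sym (negbTE ba) mulr0.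
Qed.

Variables (n : nat) (zeta : K) (pz : n.+1.-primitive_root zeta).

Lemma root_orth (a b : 'I_n.+1) :
  \sum_(x < n.+1) zeta ^+ (x * a) * (zeta ^+ (x * b))^* = n.+1%:R *+ (a == b).
Proof.
have norm1 k : zeta ^+ k * (zeta ^+ k)^* = 1.
  by rewrite -normCK normrX (norm_prim_root pz) !expr1n.
have [<-|ab] := eqVneq a b.
  by under eq_bigr => x _ do rewrite norm1; rewrite sumr_const card_ord.
pose eta := zeta ^+ a * (zeta ^+ b)^*.
rewrite (eq_bigr (fun x : 'I_n.+1 => eta ^+ x)) => [|x _]; last first.
  by rewrite exprMn -rmorphXn /= -!exprM !(mulnC x).
apply/eqP; rewrite -(@mulrI_eq0 _ (eta - 1)) -?subrX1; last first.
  apply/mulfI; rewrite subr_eq0; apply: contra ab => /eqP eta1.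
  have : zeta ^+ a == zeta ^+ b.
    by rewrite -[X in X == _]mulr1 -(norm1 b) mulrCA -/eta eta1 mulr1.
  by rewrite (eq_prim_root_expr pz) !modn_small.
by rewrite exprMn -rmorphXn -!exprM !(mulnC _ n.+1) !exprM
  (prim_expr_order pz) !expr1n rmorph1 mulr1 subrr.
Qed.

Lemma parseval_roots (q : 'I_n.+1 -> K) :
  \sum_(x < n.+1) `|\sum_k q k * zeta ^+ (x * k)| ^+ 2 =
  n.+1%:R * \sum_k `|q k| ^+ 2.
Proof. by apply: parseval => a b; exact: root_orth. Qed.

(** Exponents are at most n in each variable, so the finite torus of n.+1-th roots
    of unity already separates all monomials. *)
Lemma parseval_torus m (q : {ffun 'I_m -> 'I_n.+1} -> K) :
  \sum_(w : {ffun 'I_m -> 'I_n.+1})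
     `|\sum_a q a * \prod_l zeta ^+ (w l * a l)| ^+ 2 =
  n.+1%:R ^+ m * \sum_a `|q a| ^+ 2.
Proof.
apply: parseval => a b.
under eq_bigr => w _ do rewrite rmorph_prod -big_split /=.
rewrite -(bigA_distr_bigA (fun l (x : 'I_n.+1) =>
   zeta ^+ (x * a l) * (zeta ^+ (x * b l))^*)) /=.
under eq_bigr => l _ do rewrite root_orth.
have [->|ab] := eqVneq a b.
  by under eq_bigr => l _ do rewrite eqxx; rewrite prodr_const card_ord.
have /existsP[l abl] : [exists l, a l != b l].
  rewrite -negb_forall; apply: contra ab => /forallP ab.
  by apply/eqP/ffunP => l; apply/eqP.
by rewrite (bigD1 l) //= (negbTE abl) mul0r.
Qed.

End parseval.

(** * Elementary symmetric polynomials *)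

Lemma esymf0 (K : comNzRingType) n (w : 'I_n -> K) : esymf w 0 = 1.
Proof.
rewrite /esymf (eq_bigl (pred1 finset.set0)) => [|S]; last by rewrite cards_eq0.
by rewrite big_pred1_eq big_set0.
Qed.

Lemma esymf1 (K : comNzRingType) n (w : 'I_n -> K) : esymf w 1 = \sum_i w i.
Proof.
rewrite /esymf (eq_bigl (fun S => S \in [set [set i] | i in 'I_n]%SET)); last first.
  move=> S; apply/cards1P/imsetP => [[i ->]|[i _ ->]]; first by exists i.
  by exists i.
rewrite big_imset => [|i j _ _]; last exact: finset.set1_inj.
by apply: eq_bigr => i _; rewrite big_set1.
Qed.

Lemma esymfZ (K : comNzRingType) n (w : 'I_n -> K) u k :
  esymf (fun i => w i * u) k = u ^+ k * esymf w k.
Proof.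
rewrite /esymf mulr_sumr; apply: eq_bigr => S /eqP Sk.
by rewrite big_split /= prodr_const Sk mulrC.
Qed.

Lemma prod_esymf (K : comNzRingType) n (w : 'I_n -> K) y :
  \prod_i (w i + y) = \sum_(k < n.+1) y ^+ (n - k) * esymf w k.
Proof.
rewrite bigA_distr (partition_big (fun S : {set 'I_n} => inord #|S| : 'I_n.+1) predT) //=.
apply: eq_bigr => k _; rewrite /esymf mulr_sumr.
have cardE (S : {set 'I_n}) : (inord #|S| == k :> 'I_n.+1) = (#|S| == k).
  by rewrite -val_eqE /= inordK // ltnS -[leqRHS]card_ord max_card.
apply: eq_big => S; rewrite cardE // => /eqP Sk.
rewrite (bigID (mem S)) /= mulrC; congr (_ * _); last first.
  by apply: eq_bigr => i ->.
rewrite (eq_bigr (fun=> y)) => [|i /negbTE ->] //.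
rewrite prodr_const; congr (_ ^+ _).
by rewrite -Sk -[X in (X - _)%N](card_ord n) -(cardC (mem S)) addKn; apply: eq_card => i; rewrite !inE.
Qed.

(** The phase of b separates the degrees of the elementary symmetric
    polynomials of w. *)
Lemma parseval_prod (K : numClosedFieldType) n (zeta : K) (w : 'I_n -> K) b :
  n.+1.-primitive_root zeta ->
  \sum_(x < n.+1) `|\prod_i (w i + b * zeta ^+ x)| ^+ 2 =
  n.+1%:R * \sum_(k < n.+1) (`|b| ^+ 2) ^+ (n - k) * `|esymf w k| ^+ 2.
Proof.
move=> pz.
have revK (k : 'I_n.+1) : (n - (n - k) = k)%N by rewrite subKn // -ltnS.
have := parseval_roots pz (fun k => b ^+ k * esymf w (n - k)).
rewrite [X in _ = _ * X](reindex_inj rev_ord_inj) /=.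
under [X in _ = _ * X]eq_bigr => k _ do
  rewrite subSS revK normrM normrX exprMn -exprM mulnC exprM.
move=> <-; apply: eq_bigr => x _; rewrite prod_esymf.
rewrite (reindex_inj rev_ord_inj) /=; congr (`|_| ^+ 2).
apply: eq_bigr => k _; rewrite subSS revK exprMn -exprM.
by rewrite mulrAC.
Qed.

Lemma sum_ffun_recl (V : nmodType) (J : finType) n
    (F : {ffun 'I_n.+1 -> J} -> V) :
  \sum_w F w = \sum_(w : {ffun 'I_n -> J}) \sum_x
     F [ffun l => oapp w x (unlift ord0 l)].
Proof.
rewrite pair_big /=.
rewrite (reindex (fun p : {ffun 'I_n -> J} * J =>
  [ffun l => oapp p.1 p.2 (unlift ord0 l)])) //=.
exists (fun w : {ffun 'I_n.+1 -> J} => ([ffun l => w (lift ord0 l)], w ord0)).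
  move=> [w x] _ /=; congr pair; last by rewrite ffunE unlift_none.
  by apply/ffunP => l; rewrite !ffunE liftK.
move=> w _; apply/ffunP => l; rewrite !ffunE /=.
by case: unliftP => [j ->|->] //=; rewrite ffunE.
Qed.

Section torus_bound.
Variables (R : realType) (K : R).
Hypothesis K_univ : esymf_constant K.
Local Notation C := (real_complex R).

(** Homogeneity extends the estimate from vectors of squared norm n to all
    zero-sum vectors. *)
Lemma esymf_bound n k (w : 'I_n -> R[i]) (s : R) :
  (0 < k <= n)%N -> \sum_i w i = 0 -> \sum_i `|w i| ^+ 2 = C s ->
  `|esymf w k| ^+ 2 <= C (K * 'C(n, k)%:R * (s / n%:R) ^+ k).
Proof.
move=> /andP[k0 kn] w0 ws; have [K0 esym_le] := K_univ.
have n0 : (0 < n)%N by exact: leq_trans kn.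
have nR0 : 0 < n%:R :> R by rewrite ltr0n.
have s0 : 0 <= s.
  by rewrite -ler0c -ws sumr_ge0 // => i _; rewrite exprn_ge0.
(* if w = 0, the rescaling below would divide by zero *)
have [s_eq0|s_neq0] := eqVneq s 0.
  have wi0 i : w i = 0.
    apply/eqP; rewrite -normr_eq0 -sqrf_eq0.
    move/eqP: ws; rewrite s_eq0 rmorph0 psumr_eq0 => [|j _]; last by rewrite exprn_ge0.
    by move=> /allP/(_ i (mem_index_enum _)).
  suff -> : esymf w k = 0.
    by rewrite normr0 expr0n ler0c !mulr_ge0 ?(ltW K0) // exprn_ge0 // divr_ge0 // ltW.
  rewrite /esymf big1 // => S /eqP Sk.
  have /card_gt0P[i iS] : (0 < #|S|)%N by rewrite Sk.
  by rewrite (bigD1 i) //= wi0 mul0r.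
have s_gt0 : 0 < s by rewrite lt_neqAle eq_sym s_neq0.
pose u := C (Num.sqrt (n%:R / s)).
have u2 : `|u| ^+ 2 = C (n%:R / s).
  rewrite ger0_norm ?ler0c ?sqrtr_ge0 // -rmorphXn sqr_sqrtr //.
  by rewrite divr_ge0 ?ler0n.
have zs : \sum_i `|w i * u| ^+ 2 = n%:R.
  under eq_bigr do rewrite normrM exprMn u2.
  by rewrite -mulr_suml ws -rmorphM mulrC divfK // rmorph_nat.
have z0 : \sum_i w i * u = 0 by rewrite -mulr_suml w0 mul0r.
have CK0 : 0 <= K * 'C(n, k)%:R by rewrite mulr_ge0 // ltW.
have : `|esymf (fun i => w i * u) k| ^+ 2 <= C (K * 'C(n, k)%:R).
  rewrite -[X in C X](sqr_sqrtr CK0) rmorphXn; apply: lerXn2r; rewrite ?nnegrE ?normr_ge0 ?ler0c ?sqrtr_ge0 //.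
  exact: (esym_le n k (fun i => w i * u)).
rewrite esymfZ normrM exprMn normrX exprAC u2 -(rmorphXn C).
have c0 : 0 < (n%:R / s) ^+ k by rewrite exprn_gt0 // divr_gt0.
move=> h; rewrite rmorphM /=.
have -> : C ((s / n%:R) ^+ k) = (C ((n%:R / s) ^+ k))^-1.
  by rewrite -fmorphV -exprVn invf_div.
by rewrite ler_pdivlMr ?ltcR // mulrC.
Qed.

(** The first two cases are exact on zero-sum vectors; using the general estimate
    there would cost the terms - 1 and - s of the remainder e^s - 1 - s. *)
Definition esymf_sqr_bound n k (s : R) : R :=
  if k is 0 then 1 else if k is 1 then 0 else
  K * 'C(n, k)%:R * (s / n%:R) ^+ k.

Lemma esymf_sqr_le n k (w : 'I_n -> R[i]) (s : R) :
  (k <= n)%N -> \sum_i w i = 0 -> \sum_i `|w i| ^+ 2 = C s ->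
  `|esymf w k| ^+ 2 <= C (esymf_sqr_bound n k s).
Proof.
move=> kn w0 ws; case: k kn => [|[|k]] kn.
- by rewrite esymf0 normr1 expr1n rmorph1.
- by rewrite esymf1 w0 normr0 expr0n rmorph0.
- exact: esymf_bound.
Qed.

Variables (n : nat) (A : 'M[R[i]]_n.+1) (mu : 'I_n -> R).
Hypothesis A_col0 : exists c, (forall i, A i ord0 = c) /\ `|c| ^+ 2 = n.+1%:R^-1.
Hypothesis A_colS : forall l : 'I_n, \sum_i A i (lift ord0 l) = 0.
Hypothesis A_orth : forall l l' : 'I_n,
  \sum_i A i (lift ord0 l) * (A i (lift ord0 l'))^* = C (mu l) *+ (l == l').

Lemma orth_sum_sqr (z : 'I_n -> R[i]) :
  \sum_i `|\sum_l A i (lift ord0 l) * z l| ^+ 2 = \sum_l C (mu l) * `|z l| ^+ 2.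
Proof.
under eq_bigr do rewrite normCK rmorph_sum mulr_suml.
rewrite exchange_big; apply: eq_bigr => l _ /=.
under eq_bigr do rewrite mulr_sumr.
rewrite exchange_big (bigD1 l) //= [X in _ + X]big1 => [|l' ll'].
  under eq_bigr do rewrite rmorphM mulrACA.
  by rewrite -mulr_suml A_orth eqxx mulr1n normCK addr0.
under eq_bigr do rewrite rmorphM mulrACA.
by rewrite -mulr_suml A_orth eq_sym (negbTE ll') mul0r.
Qed.

(** The left-hand side is the average of |prod_i sum_l A_il z_l|^2 over the
    phases of z, with |z_l|^2 = t_l. For each choice of the other phases, the
    average over the phase of z_0 is computed exactly by [parseval_prod]. *)
Lemma sum_prod_coef_le (t : 'I_n.+1 -> R) : (forall l, 0 <= t l) ->
  \sum_a `|prod_coef A a| ^+ 2 * C (\prod_l t l ^+ a l) <=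
  C (\sum_(k < n.+2) (t ord0 / n.+1%:R) ^+ (n.+1 - k) *
     esymf_sqr_bound n.+1 k (\sum_l mu l * t (lift ord0 l))).
Proof.
move=> t0; have [c [Ac c2]] := A_col0.
have [zeta pz] := prim_root_exists R[i] (ltn0Sn n.+1).
pose r l := C (Num.sqrt (t l)).
have r2 l : `|r l| ^+ 2 = C (t l).
  by rewrite ger0_norm ?ler0c ?sqrtr_ge0 // -rmorphXn sqr_sqrtr.
have zeta1 (x : 'I_n.+2) : `|zeta ^+ x| ^+ 2 = 1.
  by rewrite normrX (norm_prim_root pz) !expr1n.
set s := \sum_l _; set B := C _.
have L0 : 0 < (n.+2%:R : R[i]) ^+ n.+1 by rewrite exprn_gt0 ?ltr0n.
rewrite -(ler_pM2l L0).
have := parseval_torus pz (fun a => prod_coef A a * \prod_l r l ^+ a l).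
under [in RHS]eq_bigr => a _.
  rewrite normrM exprMn normr_prod -prodrXl.
  under [X in _ * X]eq_bigr => l _ do rewrite normrX exprAC r2 -(rmorphXn C).
  rewrite -(rmorph_prod C); over.
move=> <-.
under eq_bigr => w _.
  rewrite (_ : \sum_a _ = \prod_i \sum_l A i l * (zeta ^+ w l * r l)); last first.
    rewrite prod_sumE; apply: eq_bigr => a _; rewrite -mulrA -big_split /=.
    by congr (_ * _); apply: eq_bigr => l _; rewrite exprMn exprM mulrC.
  over.
rewrite sum_ffun_recl /=.
(* the bound is spread evenly over the phases of the last n variables *)
have -> : n.+2%:R ^+ n.+1 * B =
    \sum_(w : {ffun 'I_n -> 'I_n.+2}) n.+2%:R * B.
  by rewrite sumr_const card_ffun !card_ord -[RHS]mulr_natl natrX exprSr mulrA.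
apply: ler_sum => w _.
pose z l := \sum_j A l (lift ord0 j) * (zeta ^+ w j * r (lift ord0 j)).
rewrite (eq_bigr (fun x : 'I_n.+2 => `|\prod_i (z i + c * r ord0 * zeta ^+ x)| ^+ 2));
    last first.
  move=> x _; congr (`|_| ^+ 2); apply: eq_bigr => i _.
  rewrite big_ord_recl Ac ffunE unlift_none /= addrC; congr (_ + _).
    by apply: eq_bigr => j _; rewrite ffunE liftK.
  by rewrite mulrA mulrAC.
rewrite (parseval_prod _ _ pz) ler_pM2l ?ltr0n // /B rmorph_sum.
apply: ler_sum => k _; rewrite rmorphM rmorphXn /=.
have -> : `|c * r ord0| ^+ 2 = C (t ord0 / n.+1%:R).
  by rewrite normrM exprMn c2 r2 rmorphM /= fmorphV rmorph_nat mulrC.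
rewrite ler_wpM2l ?exprn_ge0 ?ler0c ?divr_ge0 ?t0 //.
apply: esymf_sqr_le; first by rewrite -ltnS.
  rewrite exchange_big big1 // => j _.
  by rewrite -mulr_suml A_colS mul0r.
rewrite orth_sum_sqr /s rmorph_sum; apply: eq_bigr => l _.
by rewrite normrM exprMn zeta1 mul1r r2 rmorphM.
Qed.

End torus_bound.

(** * Spectral decomposition of a doubly stochastic matrix *)

Section stochastic_spectrum.
Variables (R : realType) (n : nat) (M : 'M[R]_n.+1).
Hypothesis M_ge0 : forall i j, 0 <= M i j.
Hypothesis M_sym : forall i j, M i j = M j i.
Hypothesis M_row : forall i, \sum_j M i j = 1.
Hypothesis M_psd : forall v : 'I_n.+1 -> R, 0 <= \sum_i \sum_j v i * v j * M i j.

(** The upper bound comes from the Dirichlet form sum_ij M_ij (v_i - v_j)^2, which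
    is nonnegative and equals 2 (|v|^2 - v M v). *)
Lemma eigenvalue_itv x : eigenvalue M x -> 0 <= x <= 1.
Proof.
move=> /eigenvalueP[v vM v0]; pose s := \sum_i v 0 i ^+ 2.
have s_gt0 : 0 < s.
  rewrite lt_neqAle sumr_ge0 ?andbT => [|i _]; last exact: sqr_ge0.
  rewrite eq_sym psumr_eq0 => [|i _]; last exact: sqr_ge0.
  apply: contra v0 => /allP s0; apply/eqP/rowP => i; rewrite mxE.
  by apply/eqP; have := s0 i (mem_index_enum _); rewrite sqrf_eq0.
have qE : \sum_i \sum_j v 0 i * v 0 j * M i j = x * s.
  rewrite exchange_big mulr_sumr; apply: eq_bigr => j _.
  have /rowP/(_ j) := vM; rewrite !mxE => vMj.
  rewrite expr2 mulrA -vMj mulr_suml; apply: eq_bigr => i _.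
  by rewrite mulrAC.
apply/andP; split; first by rewrite -(pmulr_lge0 _ s_gt0) -qE.
rewrite -(ler_pM2r s_gt0) mul1r -qE.
have : 0 <= \sum_i \sum_j M i j * (v 0 i - v 0 j) ^+ 2.
  by do 2 (apply: sumr_ge0 => ? _); rewrite mulr_ge0 ?sqr_ge0.
have s1 : \sum_i \sum_j M i j * v 0 i ^+ 2 = s.
  by apply: eq_bigr => i _; rewrite -mulr_suml M_row mul1r.
have s2 : \sum_i \sum_j M i j * v 0 j ^+ 2 = s.
  rewrite exchange_big -[RHS]s1; apply: eq_bigr => i _.
  by apply: eq_bigr => j _; rewrite M_sym.
have -> : \sum_i \sum_j M i j * (v 0 i - v 0 j) ^+ 2 =
    s + s - 2 * \sum_i \sum_j v 0 i * v 0 j * M i j.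
  rewrite -{1}s1 -s2 mulr_sumr -big_split -sumrB; apply: eq_bigr => i _ /=.
  rewrite mulr_sumr -big_split -sumrB; apply: eq_bigr => j _ /=.
  by ring.
by set q := (\sum_i _) => ?; lra.
Qed.

Lemma eigenvalue_one : eigenvalue M 1.
Proof.
apply/eigenvalueP; exists (const_mx 1); last first.
  by apply/eqP => /rowP/(_ 0); rewrite !mxE => /eqP; rewrite oner_eq0.
rewrite scale1r; apply/rowP => j; rewrite !mxE -[RHS](M_row j).
by apply: eq_bigr => i _; rewrite mxE mul1r.
Qed.

Variable lam : n.+1.-tuple R.
Hypothesis lam_sorted : sorted >=%R lam.
Hypothesis lam_eigen : char_poly M = \prod_(x <- lam) ('X - x%:P).
Hypothesis lam1 : lam`_1 != 1.

Lemma mem_eigenvalue x : (x \in lam) = eigenvalue M x.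
Proof. by rewrite eigenvalue_root_char lam_eigen root_prod_XsubC. Qed.

Lemma lam_anti i j : (i <= j < n.+1)%N -> lam`_j <= lam`_i.
Proof.
move=> /andP[ij jN]; have ge_tr : transitive (>=%R : rel R).
  by move=> x y z; exact: ge_trans.
have := sorted_leq_nth ge_tr (@lexx _ R) 0 lam_sorted; apply => //.
  by rewrite inE size_tuple (leq_ltn_trans ij).
by rewrite inE size_tuple.
Qed.

Lemma lam_head : lam`_0 = 1.
Proof.
apply/eqP; rewrite eq_le; apply/andP; split.
  have : lam`_0 \in lam by rewrite mem_nth // size_tuple.
  by rewrite mem_eigenvalue => /eigenvalue_itv/andP[].
have : 1 \in lam by rewrite mem_eigenvalue eigenvalue_one.
move=> /tnthP[i ->]; rewrite (tnth_nth 0).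
by apply: lam_anti; rewrite ltn_ord.
Qed.

Lemma lam_tail (l : 'I_n) : 0 <= lam`_l.+1 < 1.
Proof.
have in_itv i : (i < n.+1)%N -> 0 <= lam`_i <= 1.
  move=> iN; apply: eigenvalue_itv; rewrite -mem_eigenvalue mem_nth //.
  by rewrite size_tuple.
have n0 : (0 < n)%N by exact: leq_ltn_trans (ltn_ord l).
have /andP[-> _] := in_itv l.+1 (ltn_ord (lift ord0 l)).
apply: le_lt_trans (_ : lam`_1 < 1).
  by apply: lam_anti => /=; rewrite ltnS ltn_ord.
by rewrite lt_neqAle lam1; have /andP[] := in_itv 1%N n0.
Qed.

End stochastic_spectrum.

Section spectral_gram.
Variables (R : realType) (n : nat) (M : 'M[R]_n.+1) (lam : n.+1.-tuple R).
Hypothesis M_sym : forall i j, M i j = M j i.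
Hypothesis lam_eigen : char_poly M = \prod_(x <- lam) ('X - x%:P).
Local Notation C := (real_complex R).

Lemma conj_real (x : R) : (C x)^* = C x.
Proof. exact: conjc_real. Qed.

Lemma char_poly_conjugate (F : fieldType) m (A D P : 'M[F]_m) :
  P \in unitmx -> P *m A = D *m P -> char_poly A = char_poly D.
Proof.
move=> uP PA; pose Q := map_mx polyC P.
have QA : Q *m char_poly_mx A = char_poly_mx D *m Q.
  rewrite /char_poly_mx mulmxBr mulmxBl -!map_mxM PA; congr (_ - _).
  by rewrite -scalar_mxC.
have : \det Q != 0.
  by rewrite det_map_mx polyC_eq0 -unitfE -unitmxE.
move=> /mulfI; apply; rewrite -det_mulmx QA det_mulmx mulrC.
by [].
Qed.

(** The unitary basis of the spectral theorem is reordered so that its l-th vector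
    has eigenvalue lam_l. *)
Lemma real_symmetric_spectral : exists U : 'M[R[i]]_n.+1,
  [/\ forall l l', \sum_i U l i * (U l' i)^* = (l == l')%:R,
      forall i j, \sum_l (U l i)^* * U l j = (i == j)%:R &
      forall i j, C (M i j) = \sum_(l < n.+1) C lam`_l * ((U l i)^* * U l j)].
Proof.
pose Mc := map_mx C M.
have McT : map_mx Num.conj (Mc^T) = Mc.
  by apply/matrixP => i j; rewrite !mxE conj_real M_sym.
have /orthomx_spectralP : Mc \is normalmx by apply/normalmxP; rewrite McT.
set P := spectralmx Mc; set sp := spectral_diag Mc => McE.
have Pu : P \is unitarymx by exact: spectral_unitarymx.
have PM : P *m Mc = diag_mx sp *m P.
  by rewrite McE !mulmxA mulmxV ?mul1mx // spectral_unit.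
have cpE : \prod_(x <- [tuple C (tnth lam l) | l < n.+1]) ('X - x%:P) =
    \prod_(x <- [tuple sp 0 l | l < n.+1]) ('X - x%:P) :> {poly R[i]}.
  transitivity (char_poly Mc).
    rewrite -map_char_poly lam_eigen rmorph_prod !big_tuple.
    apply: eq_bigr => l _; rewrite tnth_mktuple /= rmorphB /= map_polyX.
    by rewrite map_polyC.
  rewrite (char_poly_conjugate (spectral_unit _) PM).
  rewrite char_poly_trig ?diag_mx_is_trig // big_tuple; apply: eq_bigr => l _.
  by rewrite tnth_mktuple mxE eqxx mulr1n.
have /tuple_permP[p pE] := prod_XsubC_eq cpE.
have lamE (l : 'I_n.+1) : C lam`_l = sp 0 (p l).
  have /(congr1 (fun t => tnth t l)) := val_inj pE.
  by rewrite !tnth_mktuple (tnth_nth 0).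
exists (\matrix_(l, i) P (p l) i); split => [l l'|i j|i j].
- have /unitarymxP/matrixP/(_ (p l) (p l')) := Pu.
  rewrite !mxE (inj_eq perm_inj) => <-; apply: eq_bigr => i _.
  by rewrite !mxE.
- have /matrixP/(_ i j) : invmx P *m P = 1%:M by rewrite mulVmx // spectral_unit.
  rewrite invmx_unitary // !mxE => <-; rewrite [RHS](reindex_inj (@perm_inj _ p)).
  by apply: eq_bigr => l _; rewrite !mxE.
- have /matrixP/(_ i j) := McE; rewrite invmx_unitary // !mxE => ->.
  rewrite (reindex_inj (@perm_inj _ p)) /=; apply: eq_bigr => l _.
  rewrite mul_mx_diag !mxE lamE; ring.
Qed.

End spectral_gram.

Section stochastic_gram.
Variables (R : realType) (n : nat) (M : 'M[R]_n.+1).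
Hypothesis M_ge0 : forall i j, 0 <= M i j.
Hypothesis M_sym : forall i j, M i j = M j i.
Hypothesis M_row : forall i, \sum_j M i j = 1.
Hypothesis M_psd : forall v : 'I_n.+1 -> R, 0 <= \sum_i \sum_j v i * v j * M i j.
Variable lam : n.+1.-tuple R.
Hypothesis lam_sorted : sorted >=%R lam.
Hypothesis lam_eigen : char_poly M = \prod_(x <- lam) ('X - x%:P).
Hypothesis lam1 : lam`_1 != 1.
Local Notation C := (real_complex R).

(** The columns of A are the eigenvectors scaled by the square roots of the
    eigenvalues. Pairing an eigenvector with the all-ones vector, which is fixed by
    M, shows that its sum vanishes unless its eigenvalue is 1. As 1 is a simple
    eigenvalue, the all-ones vector is a multiple of the first eigenvector, which
    is therefore constant. *)
Lemma stochastic_gram : exists A : 'M[R[i]]_n.+1,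
  [/\ forall i j, C (M i j) = \sum_l A i l * (A j l)^*,
      exists c, (forall i, A i ord0 = c) /\ `|c| ^+ 2 = n.+1%:R^-1,
      forall l : 'I_n, \sum_i A i (lift ord0 l) = 0 &
      forall l l' : 'I_n, \sum_i A i (lift ord0 l) * (A i (lift ord0 l'))^* =
        C lam`_l.+1 *+ (l == l')].
Proof.
have lam0 := lam_head M_ge0 M_sym M_row M_psd lam_sorted lam_eigen.
have lamS := lam_tail M_ge0 M_sym M_row M_psd lam_sorted lam_eigen lam1.
have lam_ge0 (l : 'I_n.+1) : 0 <= lam`_l.
  have [j ->|->] := unliftP ord0 l; first by have /andP[] := lamS j.
  by rewrite lam0.
have [U [Urow Ucol ME]] := real_symmetric_spectral M_sym lam_eigen.
have sqrtC (l : 'I_n.+1) : C (Num.sqrt lam`_l) * C (Num.sqrt lam`_l) = C lam`_l.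
  by rewrite -rmorphM -expr2 sqr_sqrtr.
pose p l := \sum_i U l i.
have UM l j : \sum_i U l i * C (M i j) = C lam`_l * U l j.
  under eq_bigr do rewrite ME mulr_sumr.
  rewrite exchange_big (bigD1 l) //= [X in _ + X]big1 => [|k kl].
    under eq_bigr do rewrite mulrCA [_ * (_^* * _)]mulrA.
    by rewrite -mulr_sumr -mulr_suml Urow eqxx mul1r addr0.
  under eq_bigr do rewrite mulrCA [_ * (_^* * _)]mulrA.
  by rewrite -mulr_sumr -mulr_suml Urow eq_sym (negbTE kl) mul0r mulr0.
have pE l : p l = C lam`_l * p l.
  rewrite /p mulr_sumr; under [RHS]eq_bigr do rewrite -UM.
  rewrite exchange_big; apply: eq_bigr => i _.
  by rewrite -mulr_sumr -rmorph_sum M_row rmorph1 mulr1.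
have p0 (l : 'I_n) : p (lift ord0 l) = 0.
  apply/eqP; have /eqP := pE (lift ord0 l); rewrite -subr_eq0.
  rewrite -[X in X - _]mul1r -mulrBl mulf_eq0 => /orP[|//].
  rewrite -(rmorph1 C) -rmorphB fmorph_eq0 subr_eq0 => /eqP l1.
  by have /andP[_] := lamS l; rewrite -[X in X < _]l1 ltxx.
have U0 i : (U ord0 i)^* * p ord0 = 1.
  transitivity (\sum_l (U l i)^* * p l).
    by rewrite big_ord_recl big1 ?addr0 // => l _; rewrite p0 mulr0.
  under eq_bigr do rewrite /p mulr_sumr.
  rewrite exchange_big; under eq_bigr do rewrite Ucol.
  by rewrite (bigD1 i) //= eqxx big1 ?addr0 // => j; rewrite eq_sym => /negbTE ->.
have pn0 : p ord0 != 0.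
  by apply/eqP => p00; have /eqP := U0 ord0; rewrite p00 mulr0 eq_sym oner_eq0.
have U0E i : (U ord0 i)^* = (p ord0)^-1.
  by apply: (mulIf pn0); rewrite U0 mulVf.
exists (\matrix_(i, l) ((U l i)^* * C (Num.sqrt lam`_l))); split.
- move=> i j; rewrite ME; apply: eq_bigr => l _.
  by rewrite !mxE rmorphM /= conj_real conjCK mulrACA sqrtC mulrC.
- exists (p ord0)^-1; split => [i|].
    by rewrite mxE U0E lam0 sqrtr1 rmorph1 mulr1.
  have := Urow ord0 ord0; under eq_bigr do rewrite -normCK -norm_conjC U0E.
  rewrite sumr_const card_ord eqxx => normE.
  have N0 : (n.+1%:R : R[i]) != 0 by rewrite pnatr_eq0.
  by apply: (mulfI N0); rewrite mulr_natl normE mulfV.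
- move=> l; under eq_bigr do rewrite mxE.
  by rewrite -mulr_suml -rmorph_sum -/(p _) p0 rmorph0 mul0r.
- move=> l l'; under eq_bigr do rewrite !mxE rmorphM /= conj_real conjCK mulrACA mulrC.
  rewrite -mulr_sumr; under eq_bigr do rewrite mulrC.
  rewrite Urow (inj_eq (@lift_inj _ _)) eq_sym.
  case: eqVneq => [->|_]; rewrite ?mulr0 // mulr1.
  exact: (sqrtC (lift ord0 l')).
Qed.

End stochastic_gram.

Import numFieldNormedType.Exports.
Local Open Scope classical_set_scope.

(** * Densities *)

Section density.
Context d (T : measurableType d) (R : realType).
Local Open Scope ereal_scope.

Definition has_density (nu mu : set T -> \bar R) (g : T -> R) :=
  [/\ measurable_fun [set: T] g, forall x, (0 <= g x)%R &
   forall A, measurable A -> nu A = \int[mu]_(x in A) (g x)%:E].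

Lemma density_dominates (nu : {measure set T -> \bar R})
    (mu : {measure set T -> \bar R}) g : has_density nu mu g -> nu `<< mu.
Proof.
move=> [mg g0 nuE]; apply/null_content_dominatesP => A mA muA.
by rewrite nuE // null_set_integral //; exact/measurable_EFinP/measurable_funTS.
Qed.

Lemma ge0_integral_density (nu : {finite_measure set T -> \bar R})
    (mu : {sigma_finite_measure set T -> \bar R}) g (f : T -> \bar R) :
  has_density nu mu g -> measurable_fun [set: T] f -> (forall x, 0 <= f x) ->
  \int[nu]_x f x = \int[mu]_x (f x * (g x)%:E).
Proof.
move=> dg mf f0; have numu := density_dominates dg; have [mg g0 nuE] := dg.
rewrite -(Radon_Nikodym_SigmaFinite.change_of_variables numu) //.
have mG : measurable_fun [set: T] (EFin \o g) by exact/measurable_EFinP.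
have ifg := Radon_Nikodym_SigmaFinite.f_integrable numu.
apply: ge0_ae_eq_integral => //.
- by apply: emeasurable_funM => //; exact: measurable_int ifg.
- exact: emeasurable_funM.
- by move=> x _; rewrite mule_ge0 // Radon_Nikodym_SigmaFinite.f_ge0.
- by move=> x _; rewrite mule_ge0 // lee_fin.
- apply: ae_eqe_mul2l; apply: integral_ae_eq => // E _ mE.
  by rewrite -Radon_Nikodym_SigmaFinite.f_integral // nuE.
Qed.

End density.

(** * The standard exponential law *)

Section exponential.
Variable R : realType.

(** - gamma_poly k * exp (- t) is a primitive of t^k exp (- t): it is the
    upper incomplete gamma function without its exponential factor. *)
Fixpoint gamma_poly (k : nat) : {poly R} :=
  if k is j.+1 then 'X^(j.+1) + j.+1%:R *: gamma_poly j else 1.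

Lemma gamma_poly0 k : (gamma_poly k).[0] = k`!%:R.
Proof.
elim: k => [|k IHk] /=; first by rewrite hornerE.
by rewrite !hornerE IHk expr0n add0r factS natrM.
Qed.

Lemma deriv_gamma_poly k : deriv (gamma_poly k) = gamma_poly k - 'X^k.
Proof.
elim: k => [|k IHk] /=; first by rewrite derivC expr0 subrr.
rewrite derivD derivXn derivZ IHk scalerBr -scaler_nat.
by rewrite [RHS]addrAC subrr add0r addrC subrK.
Qed.

Lemma is_derive_gamma_poly k (t : R) :
  is_derive t 1 (fun u => - ((gamma_poly k).[u] * expR (- u)))
    (t ^+ k * expR (- t)).
Proof.
have dexp : is_derive t 1 (fun u => expR (- u)) (- expR (- t)).
  apply: (is_derive_eq (is_derive1_comp (is_derive_expR _) (is_deriveNid t 1))).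
  by rewrite /GRing.scale /= ?(mulN1r, mulrN1).
apply: (is_derive_eq (is_deriveN (is_deriveM (is_derive_poly (gamma_poly k) t) dexp))).
by rewrite deriv_gamma_poly !hornerE /GRing.scale /=; ring.
Qed.

Lemma expX_cvg0 k : t ^+ k * expR (- t) @[t --> +oo] --> (0 : R).
Proof.
apply: (@squeeze_cvgr _ _ _ _ (fun=> 0) (fun t => k.+1`!%:R * t^-1)).
- near=> t; have t0 : 0 < t by near: t; exact: nbhs_pinfty_gt.
  rewrite mulr_ge0 ?expR_ge0 ?exprn_ge0 ?(ltW t0) //= expRN.
  rewrite -ler_pdivlMr ?invr_gt0 ?expR_gt0 // invrK.
  rewrite mulrAC ler_pdivlMr // -exprSr mulrC -ler_pdivrMr ?ltr0n ?fact_gt0 //.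
  by apply: le_trans (expR_ge1Dxn k (ltW t0)); rewrite lerDr.
- exact: cvg_cst.
- rewrite -[X in _ --> X](mulr0 k.+1`!%:R); apply: cvgMr.
  by apply/gtr0_cvgV0; [near=> t; near: t; exact: nbhs_pinfty_gt|exact: cvg_id].
Unshelve. all: by end_near. Qed.

Lemma gamma_poly_cvg0 k : (gamma_poly k).[t] * expR (- t) @[t --> +oo] --> (0 : R).
Proof.
elim: k => [|k IHk] /=.
  by under eq_fun do rewrite hornerE mul1r; exact: cvgr_expR.
under eq_fun do rewrite !hornerE mulrDl -mulrA.
have -> : (0 : R) = 0 + k.+1%:R * 0 by rewrite mulr0 addr0.
apply: cvgD; first exact: (expX_cvg0 k.+1).
exact: cvgMr.
Qed.

Lemma integral_gamma k :
  (\int[lebesgue_measure]_(t in `[0%R, +oo[) (t ^+ k * expR (- t))%:E =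
   (k`!%:R : R)%:E)%E.
Proof.
have cexpN : continuous (fun t : R => expR (- t)).
  by move=> t; apply: continuous_comp; [exact: oppr_continuous|exact: continuous_expR].
have cf : continuous (fun t : R => t ^+ k * expR (- t)).
  by move=> t; apply: cvgM; [exact: exprn_continuous|exact: cexpN].
rewrite (@ge0_continuous_FTC2y _ _
  (fun t => - ((gamma_poly k).[t] * expR (- t))) _ 0) //.
- by rewrite gamma_poly0 oppr0 expR0 mulr1 EFinN oppeK add0e.
- by move=> t t0; rewrite mulr_ge0 ?exprn_ge0 ?expR_ge0.
- exact: continuous_subspaceT.
- by rewrite -oppr0; apply: cvgN; exact: gamma_poly_cvg0.
- apply: cvg_at_right_filter; apply: cvgN.
  by apply: cvgM; [exact: continuous_horner|exact: cexpN].
- by move=> t _; rewrite derive1E; have [] := is_derive_gamma_poly k t.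
Qed.

Definition std_exponential : probability (measurableTypeR R) R :=
  exponential_distribution_exponential_prob__canonical__probability_measure_Probability
    (@ltr01 R).

Lemma integral_std_exponential (f : R -> R) :
  measurable_fun [set: R] f -> (forall t, 0 <= f t) ->
  (\int[std_exponential]_t (f t)%:E =
   \int[lebesgue_measure]_(t in `[0%R, +oo[) (f t * expR (- t))%:E)%E.
Proof.
move=> mf f0; rewrite (@ge0_integral_density _ _ _ std_exponential
  lebesgue_measure (exponential_pdf 1)) //; first last.
- exact/measurable_EFinP.
- split => //; first exact: measurable_exponential_pdf.
  by move=> t; exact: exponential_pdf_ge0.
rewrite [RHS]integral_mkcond; apply: eq_integral => t _.
rewrite -EFinM /exponential_pdf !patchE; case: ifPn => _; last by rewrite mulr0.
by rewrite mul1r mulN1r.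
Qed.

Lemma exponential_moment k :
  (\int[std_exponential]_t (`|t| ^+ k)%:E = (k`!%:R : R)%:E)%E.
Proof.
rewrite integral_std_exponential => [||t]; last by rewrite exprn_ge0.
  rewrite -integral_gamma; apply: eq_integral => t.
  by rewrite inE /= in_itv /= andbT => t0; rewrite ger0_norm.
by apply: measurable_funX; exact: normr_measurable.
Qed.

Lemma exponential_mgf (u : R) : u < 1 ->
  (\int[std_exponential]_t (expR (u * `|t|))%:E = ((1 - u)^-1)%:E)%E.
Proof.
move=> u1; have v0 : 0 < 1 - u by rewrite subr_gt0.
rewrite integral_std_exponential => [||t]; last by rewrite expR_ge0.
  rewrite -[RHS]mule1 -(integral_exponential_pdf v0).
  rewrite -ge0_integralZl_EFin ?invr_ge0 ?(ltW v0) //; first last.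
  - by apply/measurable_EFinP; exact: measurable_exponential_pdf.
  - by move=> t _; rewrite lee_fin; exact/exponential_pdf_ge0/ltW.
  rewrite [LHS]integral_mkcond; apply: eq_integral => t _.
  rewrite -EFinM /exponential_pdf !patchE; case: ifPn => [|_]; last by rewrite mulr0.
  rewrite inE /= in_itv /= andbT => t0; rewrite mulKf ?gt_eqF //.
  by rewrite ger0_norm // -expRD; congr (expR _)%:E; ring.
by apply: measurableT_comp => //; apply: measurable_funM => //; exact: normr_measurable.
Qed.

End exponential.

(** * Integration against product probabilities *)

Section product_integral.
Context d (T : measurableType d) (R : realType).
Local Open Scope ereal_scope.

Lemma measurable_tuple_prod n (g : 'I_n -> T -> R) :
  (forall i, measurable_fun [set: T] (g i)) ->
  measurable_fun [set: n.-tuple T] (fun t => (\prod_i g i (tnth t i))%R).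
Proof.
move=> mg; apply: measurable_prod => i _.
by apply: measurableT_comp => //; exact: measurable_tnth.
Qed.

Lemma ge0_integral_prod_proba n (P : 'I_n.+1 -> probability T R)
    (f : n.+1.-tuple T -> \bar R) :
  measurable_fun [set: n.+1.-tuple T] f -> (forall t, 0 <= f t) ->
  \int[prod_proba P]_t f t = \int[P ord0]_x
    \int[prod_proba (fun i => P (lift ord0 i))]_t f (consT (x, t)).
Proof.
move=> mf f0.
rewrite [LHS](@ge0_integral_pushforward _ _ _ _ _ _ (@measurable_consT _ T n)) //.
rewrite preimage_setT fubini_tonelli1 // => [|xt]; last exact: f0.
by apply: measurableT_comp => //; exact: measurable_consT.
Qed.

Lemma measurable_integral_prod_proba n (P : 'I_n -> probability T R)
    (f : n.+1.-tuple T -> \bar R) :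
  measurable_fun [set: n.+1.-tuple T] f -> (forall t, 0 <= f t) ->
  measurable_fun [set: T] (fun x => \int[prod_proba P]_t f (consT (x, t))).
Proof.
move=> mf f0.
apply: (@measurable_fun_fubini_tonelli_F _ _ _ _ _ _ (f \o @consT _ T n)); last first.
  by move=> xt; exact: f0.
by apply: measurableT_comp => //; exact: measurable_consT.
Qed.

Lemma measurable_consT2 n (x : T) :
  measurable_fun [set: n.-tuple T] (fun t => consT (x, t)).
Proof. by apply: measurable_cons => //; exact: measurable_id. Qed.

Lemma tnth_consTS n x (t : n.-tuple T) i :
  tnth (consT (x, t)) (lift ord0 i) = tnth t i.
Proof. by rewrite tnthS. Qed.

Lemma integral_tuple_prod n (P : 'I_n -> probability T R) (g : 'I_n -> T -> R) :
  (forall i, measurable_fun [set: T] (g i)) -> (forall i x, (0 <= g i x)%R) ->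
  \int[prod_proba P]_t (\prod_i g i (tnth t i))%:E =
  \prod_i \int[P i]_x (g i x)%:E.
Proof.
elim: n P g => [|n IHn] P g mg g0.
  under eq_integral do rewrite big_ord0.
  by rewrite big_ord0 integral_cst // mul1e; exact: probability_setT.
rewrite ge0_integral_prod_proba => [||t]; last 2 first.
- by apply/measurable_EFinP; exact: measurable_tuple_prod.
- by rewrite lee_fin prodr_ge0.
rewrite big_ord_recl -IHn // -ge0_integralZr //; first last.
- by apply: integral_ge0 => t _; rewrite lee_fin prodr_ge0.
- by move=> x _; rewrite lee_fin.
- exact/measurable_EFinP.
apply: eq_integral => x _.
rewrite -ge0_integralZl_EFin //; first last.
- apply/measurable_EFinP; exact: (measurable_tuple_prod (fun i => mg (lift ord0 i))).
- by move=> t _; rewrite lee_fin prodr_ge0.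
apply: eq_integral => t _; rewrite big_ord_recl EFinM; congr (_ * _%:E).
by apply: eq_bigr => i _; rewrite tnth_consTS.
Qed.

Definition tuple_tail n (t : n.+1.-tuple T) : n.-tuple T :=
  [tuple tnth t (lift ord0 l) | l < n].

Lemma tuple_tail_consT n x (t : n.-tuple T) : tuple_tail (consT (x, t)) = t.
Proof. by apply: eq_from_tnth => l; rewrite tnth_mktuple tnth_consTS. Qed.

Lemma measurable_tuple_tail n : measurable_fun [set: n.+1.-tuple T] (@tuple_tail n).
Proof.
apply/measurable_fun_tnthP => l.
rewrite (_ : _ \o _ = fun t => tnth t (lift ord0 l)); first exact: measurable_tnth.
by apply/funext => t; rewrite /= tnth_mktuple.
Qed.

Lemma measurable_separated n (u : T -> R) (v : n.-tuple T -> R) :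
  measurable_fun [set: T] u -> measurable_fun [set: n.-tuple T] v ->
  measurable_fun [set: n.+1.-tuple T]
    (fun t => u (tnth t ord0) * v (tuple_tail t))%R.
Proof.
move=> mu mv; apply: measurable_funM.
  by apply: measurableT_comp => //; exact: measurable_tnth.
by apply: measurableT_comp => //; exact: measurable_tuple_tail.
Qed.

Lemma ge0_integral_separated m n (P : 'I_n.+1 -> probability T R)
    (u : 'I_m -> T -> R) (v : 'I_m -> n.-tuple T -> R) :
  (forall k, measurable_fun [set: T] (u k)) -> (forall k x, (0 <= u k x)%R) ->
  (forall k, measurable_fun [set: n.-tuple T] (v k)) ->
  (forall k t, (0 <= v k t)%R) ->
  \int[prod_proba P]_t (\sum_k u k (tnth t ord0) * v k (tuple_tail t))%:E =
  \sum_k \int[P ord0]_x (u k x)%:E *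
         \int[prod_proba (fun i => P (lift ord0 i))]_t (v k t)%:E.
Proof.
move=> meas_u u0 meas_v v0.
have V0 k : 0 <= \int[prod_proba (fun i => P (lift ord0 i))]_t (v k t)%:E.
  by apply: integral_ge0 => t _; rewrite lee_fin.
rewrite ge0_integral_prod_proba => [||t]; last 2 first.
- by apply/measurable_EFinP; apply: measurable_sum => k; exact: measurable_separated.
- by rewrite lee_fin sumr_ge0 // => k _; rewrite mulr_ge0.
transitivity (\int[P ord0]_x \sum_k ((u k x)%:E *
    \int[prod_proba (fun i => P (lift ord0 i))]_t (v k t)%:E)).
  apply: eq_integral => x _.
  under eq_integral do rewrite tuple_tail_consT -sumEFin.
  rewrite ge0_integral_sum //; first last.
  - by move=> k t _; rewrite lee_fin mulr_ge0.
  - move=> k; apply/measurable_EFinP; apply: measurable_funM => //.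
    exact: (measurable_cst (u k x)).
  apply: eq_bigr => k _; rewrite -ge0_integralZl_EFin //; first last.
  - exact/measurable_EFinP.
  - by move=> t _; rewrite lee_fin.
rewrite ge0_integral_sum //; first last.
- by move=> k x _; rewrite mule_ge0 ?lee_fin.
- by move=> k; apply: emeasurable_funM => //; exact/measurable_EFinP.
apply: eq_bigr => k _; rewrite ge0_integralZr //; first last.
- by move=> x _; rewrite lee_fin.
- exact/measurable_EFinP.
Qed.

(** By induction, changing one coordinate at a time under Tonelli. *)
Lemma ge0_integral_prod_density n (nu mu : 'I_n -> probability T R)
    (g : 'I_n -> T -> R) (f : n.-tuple T -> \bar R) :
  (forall i, has_density (nu i) (mu i) (g i)) ->
  measurable_fun [set: n.-tuple T] f -> (forall t, 0 <= f t) ->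
  \int[prod_proba nu]_t f t =
  \int[prod_proba mu]_t (f t * (\prod_i g i (tnth t i))%:E).
Proof.
elim: n nu mu g f => [|n IHn] nu mu g f dg mf f0.
  by apply: eq_integral => t _; rewrite big_ord0 mule1.
have mg i : measurable_fun [set: T] (g i) by case: (dg i).
have g0 i x : (0 <= g i x)%R by case: (dg i) => _ + _; exact.
have mgg : measurable_fun [set: n.+1.-tuple T]
    (fun t => f t * (\prod_i g i (tnth t i))%:E).
  by apply: emeasurable_funM => //; apply/measurable_EFinP; exact: measurable_tuple_prod.
have mf2 x : measurable_fun [set: n.-tuple T] (fun t => f (consT (x, t))).
  by apply: measurableT_comp => //; exact: measurable_consT2.
rewrite !ge0_integral_prod_proba //; last first.
  by move=> t; rewrite mule_ge0 // lee_fin prodr_ge0.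
rewrite (ge0_integral_density (dg ord0)); first last.
- by move=> x; apply: integral_ge0.
- exact: measurable_integral_prod_proba.
apply: eq_integral => x _.
rewrite (IHn _ (fun i => mu (lift ord0 i)) (fun i => g (lift ord0 i))) //.
rewrite -ge0_integralZr ?lee_fin //; first last.
- by move=> t _; rewrite mule_ge0 // lee_fin prodr_ge0.
- apply: emeasurable_funM => //.
  apply/measurable_EFinP; exact: (measurable_tuple_prod (fun i => mg (lift ord0 i))).
apply: eq_integral => t _; rewrite -muleA -EFinM big_ord_recl.
congr (_ * _%:E); rewrite mulrC; congr (_ * _)%R.
by apply: eq_bigr => i _; rewrite tnth_consTS.
Qed.

Lemma has_density_prod n (nu mu : 'I_n -> probability T R) (g : 'I_n -> T -> R) :
  (forall i, has_density (nu i) (mu i) (g i)) ->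
  has_density (prod_proba nu) (prod_proba mu)
    (fun t => \prod_i g i (tnth t i))%R.
Proof.
move=> dg.
have mg i : measurable_fun [set: T] (g i) by case: (dg i).
have g0 i x : (0 <= g i x)%R by case: (dg i) => _ + _; exact.
split; first exact: measurable_tuple_prod.
  by move=> t; rewrite prodr_ge0.
move=> A mA; rewrite -[A in LHS]setIT -integral_indic //.
rewrite (ge0_integral_prod_density dg) //; last first.
  exact/measurable_EFinP/measurable_indic.
rewrite [RHS]integral_mkcond; apply: eq_integral => t _.
by rewrite epatch_indic muleC.
Qed.

End product_integral.

(** * Independent standard exponential variables *)

Lemma expR_partial_sum (R : realType) n (s : R) : 0 <= s ->
  1 + s + \sum_(k < n) s ^+ k.+2 / k.+2`!%:R <= expR s.
Proof.
move=> s0; have := @nondecreasing_cvgn_le _ (series (exp_coeff s)).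
move=> /(_ _ (is_cvg_series_exp_coeff s) n.+2) h.
apply: le_trans (h _); last first.
  by apply: nondecreasing_series => k _ _; exact: exp_coeff_ge0.
rewrite /series /= big_mkord !big_ord_recl /exp_coeff /=.
by rewrite expr0 fact0 !divr1 expr1 addrA.
Qed.

Section iid_exponential.
Variable R : realType.
Local Notation T := (measurableTypeR R).
Local Notation nu := (@std_exponential R).
Local Notation iid n := (prod_proba (fun _ : 'I_n => nu)).

(** The absolute value agrees with the identity on the support of the
    exponential law; it makes the pointwise estimates, which need nonnegative
    squared moduli, hold on the whole space rather than almost everywhere. *)
Definition weight n (mu : 'I_n -> R) (t : n.-tuple T) : R :=
  \sum_l mu l * `|tnth t l|.

Lemma measurable_weight n (mu : 'I_n -> R) :
  measurable_fun [set: n.-tuple T] (weight mu).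
Proof.
apply: measurable_sum => l; apply: measurable_funM => //.
apply: measurableT_comp; first exact: normr_measurable.
exact: measurable_tnth.
Qed.

Lemma weight_ge0 n (mu : 'I_n -> R) t : (forall l, 0 <= mu l) -> 0 <= weight mu t.
Proof. by move=> mu0; apply: sumr_ge0 => l _; rewrite mulr_ge0. Qed.

Lemma exp_remainder_ge0 n (mu : 'I_n -> R) t : (forall l, 0 <= mu l) ->
  0 <= expR (weight mu t) - 1 - weight mu t.
Proof.
move=> mu0; rewrite -addrA -opprD subr_ge0.
by have := expR_partial_sum 0 (weight_ge0 t mu0); rewrite big_ord0 addr0.
Qed.

Lemma measurable_exp_remainder n (mu : 'I_n -> R) :
  measurable_fun [set: n.-tuple T] (fun t => expR (weight mu t) - 1 - weight mu t).
Proof.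
have mw := measurable_weight mu.
apply: measurable_funB => //; apply: measurable_funB => //.
exact: measurableT_comp.
Qed.

Lemma measurable_monomial n (a : 'I_n -> nat) :
  measurable_fun [set: n.-tuple T] (fun t => \prod_l `|tnth t l| ^+ a l).
Proof.
apply: (@measurable_tuple_prod _ T R n (fun l x => `|x| ^+ a l)) => l.
by apply: measurable_funX; exact: normr_measurable.
Qed.

Lemma iid_moment n (a : 'I_n -> nat) :
  (\int[iid n]_t (\prod_l `|tnth t l| ^+ a l)%:E = (\prod_l (a l)`!)%:R%:E)%E.
Proof.
rewrite (integral_tuple_prod (fun=> nu) (g := fun l x => `|x| ^+ a l)); first last.
- by move=> l x; rewrite exprn_ge0.
- by move=> l; apply: measurable_funX; exact: normr_measurable.
rewrite natr_prod -prodEFin; apply: eq_bigr => l _.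
exact: exponential_moment.
Qed.

Lemma iid_mgf n (mu : 'I_n -> R) : (forall l, mu l < 1) ->
  (\int[iid n]_t (expR (weight mu t))%:E = (\prod_l (1 - mu l)^-1)%:E)%E.
Proof.
move=> mu1; under eq_integral do rewrite /weight expR_sum.
rewrite (integral_tuple_prod (fun=> nu) (g := fun l x => expR (mu l * `|x|))); first last.
- by move=> l x; rewrite expR_ge0.
- move=> l; apply: measurableT_comp => //.
  by apply: measurable_funM => //; exact: normr_measurable.
by rewrite -prodEFin; apply: eq_bigr => l _; exact: exponential_mgf.
Qed.

Lemma iid_weight n (mu : 'I_n -> R) : (forall l, 0 <= mu l) ->
  (\int[iid n]_t (weight mu t)%:E = (\sum_l mu l)%:E)%E.
Proof.
move=> mu0; under eq_integral do rewrite /weight -sumEFin.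
have mabs l : measurable_fun [set: n.-tuple T] (fun t => (`|tnth t l|%:E)%E).
  apply/measurable_EFinP; apply: measurableT_comp; first exact: normr_measurable.
  exact: measurable_tnth.
rewrite ge0_integral_sum //; first last.
- by move=> l t _; rewrite lee_fin mulr_ge0.
- by move=> l; under eq_fun do rewrite EFinM; exact: emeasurable_funM.
rewrite -sumEFin; apply: eq_bigr => l _.
under eq_integral do rewrite EFinM.
rewrite ge0_integralZl_EFin //.
(* a single coordinate is the monomial whose exponents are the indicator of l *)
have := iid_moment (fun j => (j == l) : nat).
rewrite [X in (_ = X%:R%:E)%E](bigD1 l) //= eqxx big1 => [|j /negbTE -> //].
rewrite mul1n => E; rewrite -[RHS]mule1 -E; congr (_ * _)%E.
apply: eq_integral => t _; rewrite (bigD1 l) //= eqxx expr1 big1 ?mulr1 //.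
by move=> j /negbTE ->.
Qed.

Lemma iid_exp_remainder n (mu : 'I_n -> R) : (forall l, 0 <= mu l < 1) ->
  (\int[iid n]_t (expR (weight mu t) - 1 - weight mu t)%:E =
   (\prod_l (1 - mu l)^-1 - 1 - \sum_l mu l)%:E)%E.
Proof.
move=> mu01; have mu0 l : 0 <= mu l by have /andP[] := mu01 l.
have mu1 l : mu l < 1 by have /andP[] := mu01 l.
have mw := measurable_weight mu.
(* the difference is computed from a sum of integrals of nonnegative functions *)
have : (\int[iid n]_t (expR (weight mu t))%:E =
    \int[iid n]_t (expR (weight mu t) - 1 - weight mu t)%:E +
    (1 + \int[iid n]_t (weight mu t)%:E))%E.
  have -> : (1 = \int[iid n]_t (1%:E : \bar R))%E.
    have -> : (\int[iid n]_t 1 = 1%:E * iid n setT :> \bar R)%E by exact: integral_cst.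
    by rewrite probability_setT mule1.
  rewrite -ge0_integralD //; first last.
  - exact/measurable_EFinP.
  - by move=> t _; rewrite lee_fin weight_ge0.
  rewrite -ge0_integralD //; first last.
  - by apply: emeasurable_funD => //; exact/measurable_EFinP.
  - by move=> t _; rewrite adde_ge0 // lee_fin weight_ge0.
  - by apply/measurable_EFinP; exact: measurable_exp_remainder.
  - by move=> t _; rewrite lee_fin exp_remainder_ge0.
  by apply: eq_integral => t _; rewrite -!EFinD; congr _%:E; ring.
rewrite (iid_mgf mu1) iid_weight // -EFinD -[_ - 1 - _]addrA -opprD EFinB.
by move=> ->; rewrite addeK.
Qed.

End iid_exponential.

(** * Bounding the permanent of the overlap matrix *)

Section permanent_bound.
Variables (R : realType) (K : R).
Hypothesis K_univ : esymf_constant K.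
Local Notation C := (real_complex R).
Local Notation T := (measurableTypeR R).
Local Notation iid n := (prod_proba (fun _ : 'I_n => @std_exponential R)).

Lemma measurable_esymf_sqr_bound d (X : measurableType d) n k (f : X -> R) :
  measurable_fun [set: X] f ->
  measurable_fun [set: X] (fun x => esymf_sqr_bound K n k (f x)).
Proof.
move=> mf; case: k => [|[|k]] //=; apply: measurable_funM => //.
by apply: measurable_funX; exact: measurable_funM.
Qed.

Lemma esymf_sqr_bound_ge0 n k (s : R) : 0 <= s -> 0 <= esymf_sqr_bound K n k s.
Proof.
have [K0 _] := K_univ; move=> s0; case: k => [|[|k]] //=.
apply: mulr_ge0; last by rewrite exprn_ge0 // divr_ge0.
by rewrite mulr_ge0 // ltW.
Qed.

(** The binomial coefficient cancels the factorials: the term of index k is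
    n.+1`! / n.+1 ^ n.+1 times K * s ^ k / k!, so the sum is a partial sum of
    the exponential series without its term of degree one. *)
Lemma esymf_sqr_bound_sum n (s : R) : 0 <= s ->
  \sum_(k < n.+2) ((n.+1 - k)`!%:R / n.+1%:R ^+ (n.+1 - k) *
     esymf_sqr_bound K n.+1 k s) <=
  n.+1`!%:R / n.+1%:R ^+ n.+1 * (1 + K * (expR s - 1 - s)).
Proof.
move=> s0; have [K0 _] := K_univ.
have N0 : n.+1%:R != 0 :> R by rewrite pnatr_eq0.
set D := n.+1`!%:R / n.+1%:R ^+ n.+1.
have D0 : 0 <= D by rewrite divr_ge0 // exprn_ge0.
rewrite !big_ord_recl /= mulr0 add0r mulr1 subn0 -/D mulrDr mulr1 lerD2l.
rewrite (eq_bigr (fun k : 'I_n => D * (K * (s ^+ k.+2 / k.+2`!%:R)))); last first.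
  move=> k _; rewrite /bump /= !add1n.
  have kN : (k.+2 <= n.+1)%N by rewrite ltnS ltn_ord.
  have factE : n.+1`!%:R = 'C(n.+1, k.+2)%:R * (k.+2`!%:R * (n.+1 - k.+2)`!%:R) :> R.
    by rewrite -!natrM bin_fact.
  have powE : n.+1%:R ^+ n.+1 = n.+1%:R ^+ k.+2 * n.+1%:R ^+ (n.+1 - k.+2) :> R.
    by rewrite -exprD subnKC.
  have f0 : k.+2`!%:R != 0 :> R by rewrite pnatr_eq0 -lt0n fact_gt0.
  have p1 := expf_neq0 k.+2 N0; have p2 := expf_neq0 (n.+1 - k.+2) N0.
  rewrite /D factE powE expr_div_n; move: f0 p1 p2.
  set f := k.+2`!%:R; set a := _ ^+ k.+2; set b := _ ^+ (n.+1 - k.+2).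
  set x := s ^+ k.+2; move=> f0 p1 p2.
  by field; rewrite f0 p1 p2.
rewrite -mulr_sumr -mulr_sumr ler_wpM2l // ler_wpM2l ?(ltW K0) //.
by have := expR_partial_sum n s0; set q := \sum_(k < n) _ => ?; lra.
Qed.

Definition sqr_coef n m (A : 'M[R[i]]_(n, m)) a : R :=
  complex.Re (`|prod_coef A a| ^+ 2).

Lemma sqr_coefE n m (A : 'M[R[i]]_(n, m)) a :
  C (sqr_coef A a) = `|prod_coef A a| ^+ 2.
Proof. by rewrite /sqr_coef RRe_real // realX // normr_real. Qed.

Lemma sqr_coef_ge0 n m (A : 'M[R[i]]_(n, m)) a : 0 <= sqr_coef A a.
Proof.
by have := exprn_ge0 2 (normr_ge0 (prod_coef A a)); rewrite -sqr_coefE ler0c.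
Qed.

(** The factorials in the Wick formula are the moments of the squared moduli
    of independent standard complex Gaussians, which are standard exponential
    variables. *)
Lemma permanent_gram_integral n m (M : 'M[R]_n) (A : 'M[R[i]]_(n, m)) :
  (forall i j, C (M i j) = \sum_l A i l * (A j l)^* ) ->
  ((permanent M)%:E = \int[iid m]_t
     (\sum_a sqr_coef A a * \prod_l `|tnth t l| ^+ a l)%:E)%E.
Proof.
move=> MA.
have permE : permanent M = \sum_a sqr_coef A a * (\prod_l (a l)`!)%:R.
  apply: (@complexI R).
  transitivity (permanent (\matrix_(i, j) \sum_l A i l * (A j l)^* )).
    rewrite /permanent rmorph_sum; apply: eq_bigr => s _.
    by rewrite rmorph_prod; apply: eq_bigr => i _; rewrite mxE /= MA.
  rewrite permanent_gram rmorph_sum; apply: eq_bigr => a _.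
  by rewrite rmorphM /= sqr_coefE rmorph_nat.
under eq_integral do rewrite -sumEFin.
have m0 (a : {ffun 'I_m -> 'I_n.+1}) (t : m.-tuple T) :
    0 <= \prod_l `|tnth t l| ^+ a l.
  by apply: prodr_ge0 => l _; rewrite exprn_ge0.
rewrite ge0_integral_sum //; first last.
- by move=> a t _; rewrite lee_fin mulr_ge0 // sqr_coef_ge0.
- move=> a; apply/measurable_EFinP; apply: measurable_funM => //.
  exact: measurable_monomial.
rewrite permE -sumEFin; apply: eq_bigr => a _.
rewrite EFinM -(iid_moment R (fun l => a l)) -ge0_integralZl_EFin //.
- by move=> t _; rewrite lee_fin.
- by apply/measurable_EFinP; exact: measurable_monomial.
- exact: sqr_coef_ge0.
Qed.

(** The phases are averaged out in [sum_prod_coef_le]; integrating the constant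
    direction (coordinate 0) then produces the factorials (n.+1 - k)!, and the
    remaining coordinates enter only through their weight. *)
Lemma permanent_bound n (M : 'M[R]_n.+1) (A : 'M[R[i]]_n.+1) (mu : 'I_n -> R) :
  (forall i j, C (M i j) = \sum_l A i l * (A j l)^* ) ->
  (exists c, (forall i, A i ord0 = c) /\ `|c| ^+ 2 = n.+1%:R^-1) ->
  (forall l : 'I_n, \sum_i A i (lift ord0 l) = 0) ->
  (forall l l' : 'I_n, \sum_i A i (lift ord0 l) * (A i (lift ord0 l'))^* =
     C (mu l) *+ (l == l')) ->
  (forall l, 0 <= mu l < 1) ->
  n.+1%:R ^+ n.+1 / n.+1`!%:R * permanent M <=
  1 + K * (\prod_l (1 - mu l)^-1 - 1 - \sum_l mu l).
Proof.
move=> MA A_col0 A_colS A_orth mu01; have [K0 _] := K_univ.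
have mu0 l : 0 <= mu l by have /andP[] := mu01 l.
pose u (k : 'I_n.+2) (x : T) : R := (`|x| / n.+1%:R) ^+ (n.+1 - k).
pose v (k : 'I_n.+2) (t : n.-tuple T) : R := esymf_sqr_bound K n.+1 k (weight mu t).
have u0 k x : 0 <= u k x by rewrite exprn_ge0 // divr_ge0.
have v0 k t : 0 <= v k t by apply: esymf_sqr_bound_ge0; exact: weight_ge0.
have meas_u k : measurable_fun [set: T] (u k).
  by apply: measurable_funX; apply: measurable_funM => //; exact: normr_measurable.
have meas_v k : measurable_fun [set: n.-tuple T] (v k).
  by apply: measurable_esymf_sqr_bound; exact: measurable_weight.
have int_u k : (\int[@std_exponential R]_x (u k x)%:E =
    ((n.+1 - k)`!%:R / n.+1%:R ^+ (n.+1 - k))%:E)%E.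
  under eq_integral do rewrite /u expr_div_n EFinM.
  rewrite ge0_integralZr ?lee_fin ?invr_ge0 ?exprn_ge0 //; last first.
    by apply/measurable_EFinP; apply: measurable_funX; exact: normr_measurable.
  by rewrite exponential_moment.
have c0 k : 0 <= (n.+1 - k)`!%:R / n.+1%:R ^+ (n.+1 - k) :> R.
  by rewrite divr_ge0 // exprn_ge0.
pose D : R := n.+1`!%:R / n.+1%:R ^+ n.+1.
have D0 : 0 < D by rewrite divr_gt0 // ?exprn_gt0 ?ltr0n ?fact_gt0.
rewrite -[X in X * _]invrK invf_div -/D ler_pdivrMl // -lee_fin.
rewrite (permanent_gram_integral MA).
apply: (@le_trans _ _ (\int[iid n.+1]_t
    (\sum_(k < n.+2) u k (tnth t ord0) * v k (tuple_tail t))%:E)%E).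
  apply: ge0_le_integral => //.
  - move=> t _; rewrite lee_fin sumr_ge0 // => a _; rewrite mulr_ge0 ?sqr_coef_ge0 //.
    by apply: prodr_ge0 => l _; rewrite exprn_ge0.
  - apply/measurable_EFinP; apply: measurable_sum => a; apply: measurable_funM => //.
    exact: measurable_monomial.
  - apply/measurable_EFinP; apply: measurable_sum => k.
    exact: measurable_separated.
  move=> t _; rewrite lee_fin.
  have := sum_prod_coef_le K_univ A_col0 A_colS A_orth
    (fun l => normr_ge0 (tnth t l)).
  have -> : \sum_a `|prod_coef A a| ^+ 2 * C (\prod_l `|tnth t l| ^+ a l) =
      C (\sum_a sqr_coef A a * \prod_l `|tnth t l| ^+ a l).
    by rewrite rmorph_sum; apply: eq_bigr => a _; rewrite rmorphM /= sqr_coefE.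
  rewrite lecR => /le_trans; apply; apply: ler_sum => k _.
  by rewrite /u /v /weight; under [in leRHS]eq_bigr do rewrite tnth_mktuple.
rewrite ge0_integral_separated //.
have -> : (\sum_(k < n.+2) \int[@std_exponential R]_x (u k x)%:E *
      \int[prod_proba (fun i : 'I_n => @std_exponential R)]_t (v k t)%:E =
    \int[iid n]_t
      (\sum_(k < n.+2) (n.+1 - k)`!%:R / n.+1%:R ^+ (n.+1 - k) * v k t)%:E)%E.
  under [RHS]eq_integral do rewrite -sumEFin.
  rewrite ge0_integral_sum //; first last.
  - by move=> k t _; rewrite lee_fin mulr_ge0.
  - by move=> k; apply/measurable_EFinP; exact: measurable_funM.
  apply: eq_bigr => k _; rewrite int_u -ge0_integralZl_EFin //.
  - by move=> t _; rewrite lee_fin.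
  - exact/measurable_EFinP.
have mrem := measurable_exp_remainder mu.
have rem0 t := exp_remainder_ge0 t mu0.
have -> : ((D * (1 + K * (\prod_l (1 - mu l)^-1 - 1 - \sum_l mu l)))%:E =
    \int[iid n]_t (D * (1 + K * (expR (weight mu t) - 1 - weight mu t)))%:E)%E.
  clearbody D; under eq_integral do rewrite EFinM EFinD.
  rewrite ge0_integralZl_EFin ?ltW //; first last.
  - by apply: emeasurable_funD => //; apply/measurable_EFinP; exact: measurable_funM.
  - by move=> t _; rewrite -EFinD lee_fin addr_ge0 // mulr_ge0 // ltW.
  rewrite ge0_integralD //; first last.
  - by apply/measurable_EFinP; exact: measurable_funM.
  - by move=> t _; rewrite lee_fin mulr_ge0 // ltW.
  under [X in (_ + X)%E]eq_integral do rewrite EFinM.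
  rewrite ge0_integralZl_EFin ?ltW //; first last.
  - exact/measurable_EFinP.
  - by move=> t _; rewrite lee_fin.
  rewrite (iid_exp_remainder mu01).
  have -> : (\int[iid n]_t 1 = 1%:E * iid n setT :> \bar R)%E by exact: integral_cst.
  by rewrite probability_setT mule1 EFinM EFinD EFinM.
apply: ge0_le_integral => //.
- by move=> t _; rewrite lee_fin sumr_ge0 // => k _; rewrite mulr_ge0.
- by apply/measurable_EFinP; apply: measurable_sum => k; exact: measurable_funM.
- apply/measurable_EFinP; apply: measurable_funM => //.
  by apply: measurable_funD => //; exact: measurable_funM.
- by move=> t _; rewrite lee_fin; apply: esymf_sqr_bound_sum; exact: weight_ge0.
Qed.

End permanent_bound.

(** * Mixtures and the chi-squared divergence *)

Section more_density.
Context d (T : measurableType d) (R : realType).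
Local Open Scope ereal_scope.

Lemma has_density_mixture (I : finType) (i0 : I) (P : I -> probability T R)
    (mu : probability T R) (g : I -> T -> R) :
  (forall i, has_density (P i) mu (g i)) ->
  has_density (mixture i0 P) mu (fun x => #|I|%:R^-1 * \sum_i g i x)%R.
Proof.
move=> dg.
have mg i : measurable_fun [set: T] (g i) by case: (dg i).
have g0 i x : (0 <= g i x)%R by case: (dg i) => _ + _; exact.
have gs0 x : (0 <= \sum_i g i x)%R by rewrite sumr_ge0.
have mgs : measurable_fun [set: T] (fun x => \sum_i g i x)%R.
  exact: measurable_sum.
split; first exact: measurable_funM.
  by move=> x; rewrite mulr_ge0 ?invr_ge0.
move=> A mA; under eq_integral do rewrite EFinM.
rewrite ge0_integralZl_EFin ?invr_ge0 //; first last.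
- exact/measurable_EFinP/measurable_funTS.
- by move=> x _; rewrite lee_fin.
rewrite /mixture /=; congr (_ * _).
under [RHS]eq_integral do rewrite -sumEFin.
rewrite ge0_integral_sum //; first last.
- by move=> i x _; rewrite lee_fin.
- by move=> i; exact/measurable_EFinP/measurable_funTS.
by apply: eq_bigr => i _; case: (dg i) => _ _ ->.
Qed.

Lemma has_density_ae (nu mu : probability T R) g :
  has_density nu mu g -> ae_eq mu [set: T] (density nu mu) (EFin \o g).
Proof.
move=> dg; have numu := density_dominates dg; have [mg g0 nuE] := dg.
apply: integral_ae_eq => //.
- exact: Radon_Nikodym_integrable.
- exact/measurable_EFinP.
- by move=> A _ mA; rewrite -Radon_Nikodym_integral //= nuE.
Qed.

Lemma chi2_density (nu mu : probability T R) g :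
  has_density nu mu g -> chi2 nu mu = \int[mu]_x (g x ^+ 2)%:E - 1.
Proof.
move=> dg; have numu := density_dominates dg; have [mg g0 nuE] := dg.
rewrite /chi2 asboolT //; congr (_ - 1).
have mden : measurable_fun [set: T] (density nu mu).
  by apply: measurable_int; exact: Radon_Nikodym_integrable.
apply: ae_eq_integral => //.
- exact: emeasurable_funM.
- exact/measurable_EFinP/measurable_funX.
apply: filterS (has_density_ae dg) => x /= gx _.
by rewrite gx // EFin_expe.
Qed.

End more_density.

(** * The overlap matrix *)

Section overlap.
Context d (T : measurableType d) (R : realType) (n : nat).
Variable P : 'I_n.+1 -> probability T R.
Let Pbar : probability T R := mixture ord0 P.
Let M := overlap_mx P.
Local Open Scope ereal_scope.

Let N_neq0 : (n.+1%:R != 0 :> R)%R. Proof. by rewrite pnatr_eq0. Qed.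

Let PbarE A : Pbar A = (n.+1%:R^-1)%:E * \sum_i P i A.
Proof. by rewrite /Pbar /= /mixture card_ord. Qed.

Let P_dominated i : P i `<< Pbar.
Proof.
apply/null_content_dominatesP => A mA PA0.
have /eqP : (n.+1%:R^-1)%:E * \sum_i P i A = 0 by rewrite -PbarE.
rewrite mule_eq0 eqe invr_eq0 (negbTE N_neq0) /= seq_psume_eq0 // => /allP /(_ i).
by rewrite mem_index_enum => /(_ isT) /eqP.
Qed.

(** Radon-Nikodym derivatives add up to n.+1 only almost everywhere; replacing them
    by 1 on the exceptional null set makes the identity pointwise, which also gives
    a pointwise bound on each of them. *)
Lemma exists_densities : exists g : 'I_n.+1 -> T -> R,
  (forall i, has_density (P i) Pbar (g i)) /\
  (forall x, \sum_i g i x = n.+1%:R)%R.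
Proof.
pose f i := Radon_Nikodym_SigmaFinite.f (P i) Pbar.
have fi i : Pbar.-integrable [set: T] (f i).
  exact: (Radon_Nikodym_SigmaFinite.f_integrable (P_dominated i)).
have f0 i x : 0 <= f i x by exact: (Radon_Nikodym_SigmaFinite.f_ge0 (P_dominated i)).
have fE i A : measurable A -> P i A = \int[Pbar]_(x in A) f i x.
  exact: (Radon_Nikodym_SigmaFinite.f_integral (P_dominated i)).
have mf i : measurable_fun [set: T] (f i) by exact: measurable_int (fi i).
pose h i x := fine (f i x).
have hE i x : (h i x)%:E = f i x.
  by rewrite fineK //; exact: (Radon_Nikodym_SigmaFinite.f_fin_num (P_dominated i)).
have mh i : measurable_fun [set: T] (h i) by exact: measurableT_comp.
have h0 i x : (0 <= h i x)%R by rewrite -lee_fin hE.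
pose good x := (\sum_i h i x == n.+1%:R)%R.
have mS : measurable_fun [set: T] (fun x => \sum_i h i x)%R.
  exact: measurable_sum.
have mgood : measurable_fun [set: T] good.
  by apply: measurable_fun_eqr => //; exact: measurable_cst.
have ae_good : {ae Pbar, forall x, good x}.
  have : ae_eq Pbar [set: T] (cst n.+1%:R%:E) (fun x => \sum_i f i x).
    apply: integral_ae_eq => //.
    - exact: finite_measure_integrable_cst.
    - exact: emeasurable_sum.
    - move=> A _ mA; transitivity (n.+1%:R%:E * Pbar A); first exact: integral_cst.
      rewrite PbarE muleA -EFinM.
      rewrite mulfV // mul1e ge0_integral_sum //; last first.
        by move=> i; exact: measurable_funTS.
      by apply: eq_bigr => i _; rewrite fE.
  apply: filterS => x Nx; rewrite /good eq_sym -eqe -sumEFin; apply/eqP.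
  by rewrite [LHS]Nx //; apply: eq_bigr => i _; rewrite hE.
exists (fun i x => if good x then h i x else 1%R); split => [i|x]; last first.
  case: (boolP (good x)) => [/eqP //|_].
  by rewrite sumr_const card_ord.
have mg : measurable_fun [set: T] (fun x => if good x then h i x else 1%R).
  exact: measurable_fun_ifT.
split => // [x|A mA]; first by case: ifP.
rewrite fE //; apply: ae_eq_integral => //.
- exact: measurable_funTS.
- exact/measurable_EFinP/measurable_funTS.
- by apply: filterS ae_good => x gx _; rewrite gx hE.
Qed.

Variable g : 'I_n.+1 -> T -> R.
Hypothesis dg : forall i, has_density (P i) Pbar (g i).
Hypothesis gsum : forall x, (\sum_i g i x = n.+1%:R)%R.

Let mg i : measurable_fun [set: T] (g i). Proof. by case: (dg i). Qed.
Let g0 i x : (0 <= g i x)%R. Proof. by case: (dg i) => _ + _; exact. Qed.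

Lemma overlapE i j :
  (n.+1%:R * M i j)%:E = \int[Pbar]_x (g i x * g j x)%:E.
Proof.
have mgg : measurable_fun [set: T] (fun x => g i x * g j x)%R.
  exact: measurable_funM.
have le_gN k x : (g k x <= n.+1%:R)%R.
  by rewrite -(gsum x) (bigD1 k) //= lerDl sumr_ge0.
have fin : \int[Pbar]_x (g i x * g j x)%:E \is a fin_num.
  rewrite ge0_fin_numE; last by apply: integral_ge0 => x _; rewrite lee_fin mulr_ge0.
  apply: (@le_lt_trans _ _ (\int[Pbar]_x (n.+1%:R * n.+1%:R)%:E)).
    apply: ge0_le_integral => //.
    - by move=> x _; rewrite lee_fin mulr_ge0.
    - exact/measurable_EFinP.
    - by move=> x _; rewrite lee_fin ler_pM.
  have -> : \int[Pbar]_x (n.+1%:R * n.+1%:R : R)%:E = (n.+1%:R * n.+1%:R)%:E * Pbar setT.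
    exact: integral_cst.
  by rewrite probability_setT mule1 ltry.
rewrite -[RHS]fineK //; congr _%:E.
rewrite /M /overlap_mx mxE mulrA mulfV // mul1r; congr fine.
have mden k : measurable_fun [set: T] (density (P k) Pbar).
  by apply: measurable_int; apply: Radon_Nikodym_integrable; exact: (P_dominated k).
apply: ae_eq_integral => //.
- by apply: emeasurable_funM; exact: mden.
- exact/measurable_EFinP.
apply: filterS2 (has_density_ae (dg i)) (has_density_ae (dg j)) => x gi gj _ /=.
by rewrite gi // gj.
Qed.

Lemma overlap_ge0 i j : (0 <= M i j)%R.
Proof.
rewrite -(@pmulr_rge0 _ n.+1%:R) ?ltr0n // -lee_fin overlapE.
by apply: integral_ge0 => x _; rewrite lee_fin mulr_ge0.
Qed.

Lemma overlap_sym i j : (M i j = M j i)%R.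
Proof.
apply: (mulfI N_neq0); apply: EFin_inj; rewrite !overlapE.
by apply: eq_integral => x _; rewrite mulrC.
Qed.

Lemma overlap_row_sum i : (\sum_j M i j = 1)%R.
Proof.
apply: (mulfI N_neq0); apply: EFin_inj.
rewrite mulr_sumr -sumEFin; under eq_bigr do rewrite overlapE.
rewrite -ge0_integral_sum //; first last.
- by move=> j x _; rewrite lee_fin mulr_ge0.
- by move=> j; apply/measurable_EFinP; exact: measurable_funM.
under eq_integral do rewrite sumEFin -mulr_sumr gsum mulrC EFinM.
rewrite ge0_integralZl_EFin //; first last.
- exact/measurable_EFinP.
- by move=> x _; rewrite lee_fin.
by case: (dg i) => _ _ <- //; rewrite probability_setT mulr1 mule1.
Qed.

Let form (v w : 'I_n.+1 -> R) := (\sum_i \sum_j v i * w j * M i j)%R.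

Let formE (v w : 'I_n.+1 -> R) : (forall i, 0 <= v i)%R -> (forall i, 0 <= w i)%R ->
  (n.+1%:R * form v w)%:E =
  \int[Pbar]_x ((\sum_i v i * g i x) * (\sum_i w i * g i x))%:E.
Proof.
move=> v0 w0.
have m2 i j : measurable_fun [set: T]
    (fun x => (v i * w j * (g i x * g j x))%:E).
  by apply/measurable_EFinP; apply: measurable_funM => //; exact: measurable_funM.
have p2 i j x : 0 <= (v i * w j * (g i x * g j x))%:E.
  by rewrite lee_fin !mulr_ge0.
transitivity (\sum_i \sum_j \int[Pbar]_x (v i * w j * (g i x * g j x))%:E).
  rewrite /form mulr_sumr -sumEFin; apply: eq_bigr => i _.
  rewrite mulr_sumr -sumEFin; apply: eq_bigr => j _.
  rewrite mulrCA EFinM overlapE -ge0_integralZl_EFin ?mulr_ge0 //.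
  - by move=> x _; rewrite lee_fin mulr_ge0.
  - by apply/measurable_EFinP; exact: measurable_funM.
under eq_bigr do rewrite -ge0_integral_sum //.
rewrite -ge0_integral_sum //; first last.
- by move=> i x _; exact: sume_ge0.
- by move=> i; exact: emeasurable_sum.
apply: eq_integral => x _; rewrite mulr_suml -sumEFin; apply: eq_bigr => i _.
rewrite mulr_sumr -sumEFin; apply: eq_bigr => j _.
by rewrite mulrACA.
Qed.

(** Splitting v into positive and negative parts reduces the claim to the pointwise
    inequality 2 a b <= a^2 + b^2 between nonnegative functions. *)
Lemma overlap_psd (v : 'I_n.+1 -> R) : (0 <= \sum_i \sum_j v i * v j * M i j)%R.
Proof.
pose vp i := Num.max (v i) 0%R; pose vn i := Num.max (- v i)%R 0%R.
have vp0 i : (0 <= vp i)%R by rewrite le_max lexx orbT.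
have vn0 i : (0 <= vn i)%R by rewrite le_max lexx orbT.
have vE i : (v i = vp i - vn i)%R.
  rewrite /vp /vn; have [v0|v0] := leP 0%R (v i).
    by rewrite max_r ?oppr_le0 // subr0.
  by rewrite max_l ?oppr_ge0 ?ltW // sub0r opprK.
have formB : (\sum_i \sum_j v i * v j * M i j =
    (form vp vp + form vn vn) - (form vp vn + form vp vn))%R.
  have symf : form vn vp = form vp vn.
    rewrite /form exchange_big; apply: eq_bigr => i _; apply: eq_bigr => j _.
    by rewrite overlap_sym (mulrC (vn _)).
  rewrite -{2}symf /form -!big_split -sumrB /=; apply: eq_bigr => i _.
  rewrite -!big_split -sumrB /=; apply: eq_bigr => j _.
  by rewrite !vE; ring.
rewrite formB subr_ge0 -(@ler_pM2l _ n.+1%:R) ?ltr0n // !mulrDr -lee_fin !EFinD.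
have mlin u : measurable_fun [set: T] (fun x => \sum_i u i * g i x)%R.
  by apply: measurable_sum => i; exact: measurable_funM.
have lin0 u x : (forall i, 0 <= u i)%R -> (0 <= \sum_i u i * g i x)%R.
  by move=> u0; rewrite sumr_ge0 // => i _; rewrite mulr_ge0.
rewrite !formE // -!ge0_integralD //; try by [
  move=> x _; rewrite lee_fin mulr_ge0 // lin0 |
  apply/measurable_EFinP; exact: measurable_funM].
apply: ge0_le_integral => //.
- by move=> x _; rewrite adde_ge0 // lee_fin mulr_ge0 // lin0.
- by apply: emeasurable_funD; apply/measurable_EFinP; exact: measurable_funM.
- by apply: emeasurable_funD; apply/measurable_EFinP; exact: measurable_funM.
move=> x _; rewrite -!EFinD lee_fin.
set a := (\sum_i vp i * _)%R; set b := (\sum_i vn i * _)%R.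
by rewrite -subr_ge0 (_ : _ - _ = (a - b) ^+ 2)%R ?sqr_ge0 //; ring.
Qed.

(** The squared density is a double sum over permutations s, s'; each term
    integrates to a product of overlaps that depends only on the composite of s'
    with the inverse of s. *)
Lemma chi2_permanent :
  chi2 (mixture (1%g : 'S_n.+1) (fun s => prod_proba (fun i => P (s i))))
       (prod_proba (fun=> Pbar)) =
  (n.+1%:R ^+ n.+1 / n.+1`!%:R * permanent M - 1)%:E.
Proof.
pose c : R := #|{: 'S_n.+1}|%:R^-1%R.
have c0 : (0 <= c)%R by rewrite invr_ge0.
have dgs (s : 'S_n.+1) := has_density_prod (fun i => dg (s i)).
have mgs (s s' : 'S_n.+1) : measurable_fun [set: n.+1.-tuple T]
    (fun t => \prod_i (g (s i) (tnth t i) * g (s' i) (tnth t i)))%R.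
  apply: (measurable_tuple_prod (g := fun i x => g (s i) x * g (s' i) x)%R) => i.
  exact: measurable_funM.
have gs0 (s s' : 'S_n.+1) (t : n.+1.-tuple T) :
    (0 <= \prod_i (g (s i) (tnth t i) * g (s' i) (tnth t i)))%R.
  by rewrite prodr_ge0 // => i _; rewrite mulr_ge0.
rewrite (chi2_density (has_density_mixture 1%g dgs)) EFinB; congr (_ - _).
transitivity (\int[prod_proba (fun=> Pbar)]_t ((c ^+ 2)%:E *
    \sum_(s : 'S_n.+1) \sum_(s' : 'S_n.+1)
     (\prod_i (g (s i) (tnth t i) * g (s' i) (tnth t i)))%:E)).
  apply: eq_integral => t _.
  rewrite exprMn EFinM; congr (_ * _).
  rewrite expr2 mulr_suml -sumEFin; apply: eq_bigr => s _.
  rewrite mulr_sumr -sumEFin; apply: eq_bigr => s' _.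
  by rewrite -big_split.
rewrite ge0_integralZl_EFin ?sqr_ge0 //; first last.
- by apply: emeasurable_sum => s; apply: emeasurable_sum => s'; exact/measurable_EFinP.
- by move=> t _; apply: sume_ge0 => s _; apply: sume_ge0 => s' _; rewrite lee_fin.
rewrite ge0_integral_sum //; first last.
- by move=> s t _; apply: sume_ge0 => s' _; rewrite lee_fin.
- by move=> s; apply: emeasurable_sum => s'; exact/measurable_EFinP.
transitivity ((c ^+ 2)%:E * \sum_(s : 'S_n.+1) \sum_(s' : 'S_n.+1)
    (n.+1%:R ^+ n.+1 * \prod_i M (s i) (s' i))%:E).
  congr (_ * _); apply: eq_bigr => s _.
  rewrite ge0_integral_sum //; first last.
  - by move=> s' t _; rewrite lee_fin.
  - by move=> s'; exact/measurable_EFinP.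
  apply: eq_bigr => s' _.
  rewrite (integral_tuple_prod (fun=> Pbar)
    (g := fun i x => g (s i) x * g (s' i) x)%R); first last.
  - by move=> i x; rewrite mulr_ge0.
  - by move=> i; exact: measurable_funM.
  transitivity (\prod_i (n.+1%:R * M (s i) (s' i))%:E).
    by apply: eq_bigr => i _; rewrite overlapE.
  by rewrite prodEFin big_split /= prodr_const card_ord.
under eq_bigr do rewrite sumEFin.
rewrite sumEFin -EFinM; congr _%:E.
have -> : (\sum_(s : 'S_n.+1) \sum_(s' : 'S_n.+1)
    (n.+1%:R ^+ n.+1 * \prod_i M (s i) (s' i)) =
    \sum_(s : 'S_n.+1) n.+1%:R ^+ n.+1 * permanent M)%R.
  apply: eq_bigr => s _; rewrite -mulr_sumr; congr (_ * _)%R.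
  rewrite (reindex_inj (mulgI s)); apply: eq_bigr => u _.
  rewrite [RHS](reindex_inj (@perm_inj _ s)) /=; apply: eq_bigr => i _.
  by rewrite permM.
rewrite sumr_const -[X in (_ * X)%R]mulr_natl /c.
have cardS : #|{: 'S_n.+1}| = n.+1`! by rewrite -(card_Sn n.+1); apply: eq_card.
have f0 : (n.+1`!%:R != 0 :> R)%R by rewrite pnatr_eq0 -lt0n fact_gt0.
rewrite cardS; set e := (n.+1%:R ^+ n.+1)%R.
by field.
Qed.

End overlap.

Local Close Scope classical_set_scope.

Theorem corollary1p4 (R : realType) (C : R) (C_univ : esymf_constant C)
  (d : measure_display) (T : measurableType d)
  (n : nat) (P : 'I_n.+1 -> probability T R)
  (lam : n.+1.-tuple R)
  (lam_sorted : sorted >=%R lam)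
  (lam_eigen : char_poly (overlap_mx P) = \prod_(x <- lam) ('X - x%:P)) :
  (chi2
     (mixture (1%g : 'S_n.+1) (fun s => prod_proba (fun i => P (s i))))
     (prod_proba (fun=> mixture ord0 P))
   <=
   if (lam`_1 == 1)%R then +oo
   else (C * (\prod_(1 <= i < n.+1) (1 - lam`_i)^-1
              - 1 - \sum_(1 <= i < n.+1) lam`_i))%R%:E)%E.
Proof.
case: ifPn => [_|lam1]; first exact: leey.
have [g [dg gsum]] := exists_densities P.
have M_ge0 := overlap_ge0 dg gsum; have M_sym := overlap_sym dg gsum.
have M_row := overlap_row_sum dg gsum; have M_psd := overlap_psd dg gsum.
have [A [MA A_col0 A_colS A_orth]] :=
  stochastic_gram M_ge0 M_sym M_row M_psd lam_sorted lam_eigen lam1.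
have lam01 := lam_tail M_ge0 M_sym M_row M_psd lam_sorted lam_eigen lam1.
rewrite (chi2_permanent dg gsum) lee_fin lerBlDl !big_add1 !big_mkord.
exact: (permanent_bound C_univ MA A_col0 A_colS A_orth lam01).
Qed.
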